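(* Let $J\in\mathbb{C}^{q\times q}$ be a signature matrix, let $f\in\mathbb{C}^{q\times q}\langle\langle z_1,\ldots,z_N\rangle\rangle_{\rm rat}$ be a rational formal power series, and let $\alpha=(N;A,B,C,D;\mathbb{C}^\gamma=\bigoplus_{k=1}^N\mathbb{C}^{\gamma_k},\mathbb{C}^q)$ be a minimal GR-realization of $f$. Then $f$ is matrix-$J$-unitary on $\mathcal{T}_N$ if and only if there exists an invertible Hermitian matrix $H={\rm diag}(H_1,\ldots,H_N)$, with $H_k\in\mathbb{C}^{\gamma_k\times\gamma_k}$, $k=1,\ldots,N$, which satisfies $$\begin{pmatrix}A&B\\C&D\end{pmatrix}^*\begin{pmatrix}H&0\\0&J\end{pmatrix}\begin{pmatrix}A&B\\C&D\end{pmatrix}=\begin{pmatrix}H&0\\0&J\end{pmatrix},$$ or, equivalently, $$\begin{pmatrix}A&B\\C&D\end{pmatrix}\begin{pmatrix}H^{-1}&0\\0&J\end{pmatrix}\begin{pmatrix}A&B\\C&D\end{pmatrix}^*=\begin{pmatrix}H^{-1}&0\\0&J\end{pmatrix}.$$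
   Context: Formal power series. $\mathcal{F}_N$ is the free monoid on generators $g_1,\ldots,g_N$ with empty word $\emptyset$. A formal power series (FPS) in non-commuting indeterminates $z_1,\ldots,z_N$ is $f(z)=\sum_{w\in\mathcal{F}_N}f_wz^w$, where $z^w=z_{i_1}\cdots z_{i_n}$ for $w=g_{i_1}\cdots g_{i_n}$; the indeterminates commute with coefficients and products are by convolution over factorizations of words. A scalar FPS is rational if it is obtained from non-commutative polynomials by finitely many sums, products and inversions (of FPSs with non-zero constant term); a matrix FPS is rational if all its entries are. $\mathbb{C}^{q\times q}\langle\langle z_1,\ldots,z_N\rangle\rangle_{\rm rat}$ is the space of rational FPSs with $q\times q$ coefficients. GR-nodes. A GR-node $\alpha=(N;A,B,C,D;\mathbb{C}^r=\bigoplus_{k=1}^N\mathbb{C}^{r_k},\mathbb{C}^q)$ consists of matrices $A\in\mathbb{C}^{r\times r}$, $B\in\mathbb{C}^{r\times q}$, $C\in\mathbb{C}^{q\times r}$, $D\in\mathbb{C}^{q\times q}$, with blocks $A_{ij},B_i,C_j$ along the decomposition of $\mathbb{C}^r$. Its transfer function is the rational FPS $T^{\rm nc}_\alpha(z)=D+C(I_r-\Delta(z)A)^{-1}\Delta(z)B$ with $\Delta(z)={\rm diag}(z_1I_{r_1},\ldots,z_NI_{r_N})$, i.e. the coefficient at $\emptyset$ is $D$ and at $w=g_{j_1}\cdots g_{j_n}$ it is $C_{j_1}A_{j_1j_2}\cdots A_{j_{n-1}j_n}B_{j_n}$. $\alpha$ is a GR-realization of $f$ if $T_\alpha^{\rm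 nc}=f$; it is minimal if each $r_k$ ($k=1,\ldots,N$) is the smallest possible among all GR-realizations of $f$. For minimal realizations one writes $\gamma_k$ for $r_k$ and $\gamma=\sum_k\gamma_k$. Evaluation. For $Z=(Z_1,\ldots,Z_N)\in(\mathbb{C}^{n\times n})^N$, $f(Z)$ is obtained by substituting $Z_k$ for $z_k$ in a rational expression for $f$; near $Z=0$ it equals $\sum_wf_w\otimes Z^w$, and it is a $\mathbb{C}^{q\times q}\otimes\mathbb{C}^{n\times n}$-valued rational function of the entries of the $Z_k$, defined (holomorphic) on an open dense set containing a neighbourhood of $0$. Matrix-$J$-unitarity. A signature matrix is $J$ with $J=J^*=J^{-1}$. Let $\mathbb{T}^{n\times n}$ be the set of unitary $n\times n$ complex matrices and $\mathcal{T}_N=\coprod_{n\in\mathbb{N}}(\mathbb{T}^{n\times n})^N$. A rational FPS $f$ is matrix-$J$-unitary on $\mathcal{T}_N$ if for every $n\in\mathbb{N}$, $f(W)(J\otimes I_n)f(W)^*=J\otimes I_n$ at all $W\in(\mathbb{T}^{n\times n})^N$ where $f(W)$ is defined. *)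

(* Defs.v *)
From HB Require Import structures.
From mathcomp Require Import all_boot all_order all_algebra.
From mathcomp Require Import reals.
From mathcomp.real_closed Require Import complex mxtens.

Set Implicit Arguments.
Unset Strict Implicit.
Unset Printing Implicit Defensive.

Import Order.TTheory GRing.Theory Num.Theory.
Local Open Scope ring_scope.
Local Open Scope sesquilinear_scope.

(* The free monoid on g_1, ..., g_N is [seq 'I_N]; a formal power series is its
   coefficient function [seq 'I_N -> _]. *)

Definition fps_const (K : fieldType) (N : nat) (c : K) (w : seq 'I_N) : K :=
  if w is [::] then c else 0.

Definition fps_var (K : fieldType) (N : nat) (i : 'I_N) (w : seq 'I_N) : K :=
  (w == [:: i])%:R.

Definition fps_add (K : fieldType) (N : nat) (f g : seq 'I_N -> K)
    (w : seq 'I_N) : K :=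
  f w + g w.

(* [(take i w, drop i w)], [0 <= i <= size w], are all the factorizations
   of [w] into two words. *)
Definition fps_mul (K : fieldType) (N : nat) (f g : seq 'I_N -> K)
    (w : seq 'I_N) : K :=
  \sum_(i < (size w).+1) f (take i w) * g (drop i w).

Inductive ncrat (K : Type) (N : nat) : Type :=
  | NCConst of K
  | NCVar of 'I_N
  | NCAdd of ncrat K N & ncrat K N
  | NCMul of ncrat K N & ncrat K N
  | NCInv of ncrat K N.

(* [represents e f]: all the inversions in [e] are of series with nonzero
   constant term, and the series denoted by [e] is [f]. *)
Fixpoint represents (K : fieldType) (N : nat) (e : ncrat K N)
    (f : seq 'I_N -> K) : Prop :=
  match e with
  | NCConst c => f =1 fps_const c
  | NCVar i => f =1 fps_var K i
  | NCAdd e1 e2 => exists f1 f2,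
      [/\ represents e1 f1, represents e2 f2 & f =1 fps_add f1 f2]
  | NCMul e1 e2 => exists f1 f2,
      [/\ represents e1 f1, represents e2 f2 & f =1 fps_mul f1 f2]
  | NCInv e1 => exists f1,
      [/\ represents e1 f1, f1 [::] != 0,
          fps_mul f1 f =1 fps_const 1 & fps_mul f f1 =1 fps_const 1]
  end.

Definition fps_entry (K : fieldType) (N q : nat) (f : seq 'I_N -> 'M[K]_q)
    (i j : 'I_q) : seq 'I_N -> K :=
  fun w => f w i j.

Definition rational_fps (K : fieldType) (N q : nat)
    (f : seq 'I_N -> 'M[K]_q) : Prop :=
  forall i j, exists e : ncrat K N, represents e (fps_entry f i j).

(* Substitution of matrices in an expression; [invmx] is total, so the value is
   meaningful only when [ncrat_defined] holds. *)
Fixpoint ncrat_eval (K : fieldType) (N n : nat) (Z : 'I_N -> 'M[K]_n)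
    (e : ncrat K N) : 'M[K]_n :=
  match e with
  | NCConst c => c%:M
  | NCVar i => Z i
  | NCAdd e1 e2 => ncrat_eval Z e1 + ncrat_eval Z e2
  | NCMul e1 e2 => ncrat_eval Z e1 *m ncrat_eval Z e2
  | NCInv e1 => invmx (ncrat_eval Z e1)
  end.

Fixpoint ncrat_defined (K : fieldType) (N n : nat) (Z : 'I_N -> 'M[K]_n)
    (e : ncrat K N) : bool :=
  match e with
  | NCConst _ | NCVar _ => true
  | NCAdd e1 e2 | NCMul e1 e2 => ncrat_defined Z e1 && ncrat_defined Z e2
  | NCInv e1 => ncrat_defined Z e1 && (ncrat_eval Z e1 \in unitmx)
  end.

(* [fps_value f Z V]: f(Z) is defined and equal to V, i.e. every entry of f has
   some rational expression that can be evaluated at Z.  With the convention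
   [*t] = (x) of mxtens, near 0 this is V = \sum_w f_w (x) Z^w, so the
   (i, j) block of V is the value at Z of the (i, j) entry of f. *)
Definition fps_value (K : fieldType) (N q n : nat) (f : seq 'I_N -> 'M[K]_q)
    (Z : 'I_N -> 'M[K]_n) (V : 'M[K]_(q * n)) : Prop :=
  forall i j : 'I_q, exists e : ncrat K N,
    [/\ represents e (fps_entry f i j), ncrat_defined Z e &
        ncrat_eval Z e =
          \matrix_(a, b) V (mxtens_index (i, a)) (mxtens_index (j, b))].

Record GR_node (K : fieldType) (N q : nat) : Type := GRNode {
  gr_dim : 'I_N -> nat;
  gr_A : 'M[K]_(\sum_k gr_dim k);
  gr_B : 'M[K]_(\sum_k gr_dim k, q);
  gr_C : 'M[K]_(q, \sum_k gr_dim k);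
  gr_D : 'M[K]_q
}.

(* A_{j j_2} ... A_{j_(n-1) j_n} B_{j_n}, for the word g_j g_{j_2} ... g_{j_n}. *)
Fixpoint gr_state (K : fieldType) (N q : nat) (al : GR_node K N q)
    (j : 'I_N) (w : seq 'I_N) : 'M[K]_(gr_dim al j, q) :=
  match w with
  | [::] => submxcol (gr_B al) j
  | k :: w' => submxblock (gr_A al) j k *m gr_state al k w'
  end.

(* The coefficients of D + C (I - Delta(z) A)^-1 Delta(z) B. *)
Definition gr_transfer (K : fieldType) (N q : nat) (al : GR_node K N q)
    (w : seq 'I_N) : 'M[K]_q :=
  match w with
  | [::] => gr_D al
  | j :: w' => submxrow (gr_C al) j *m gr_state al j w'
  end.

Definition gr_realization (K : fieldType) (N q : nat) (al : GR_node K N q)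
    (f : seq 'I_N -> 'M[K]_q) : Prop :=
  gr_transfer al =1 f.

Definition minimal_gr_realization (K : fieldType) (N q : nat)
    (al : GR_node K N q) (f : seq 'I_N -> 'M[K]_q) : Prop :=
  gr_realization al f /\
  forall be : GR_node K N q, gr_realization be f ->
    forall k, (gr_dim al k <= gr_dim be k)%N.

Definition gr_matrix (K : fieldType) (N q : nat) (al : GR_node K N q) :
    'M[K]_(\sum_k gr_dim al k + q) :=
  block_mx (gr_A al) (gr_B al) (gr_C al) (gr_D al).

Definition signature_mx (C : numClosedFieldType) (q : nat) (J : 'M[C]_q) : Prop :=
  J = J^t* /\ J *m J = 1%:M.

Definition matrix_J_unitary (C : numClosedFieldType) (N q : nat) (J : 'M[C]_q)
    (f : seq 'I_N -> 'M[C]_q) : Prop :=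
  forall (n : nat), (0 < n)%N ->
  forall W : 'I_N -> 'M[C]_n, (forall k, W k \is unitarymx) ->
  forall V : 'M[C]_(q * n), fps_value f W V ->
    V *m (J *t 1%:M) *m V^t* = J *t 1%:M.

(* Main.v *)
Require Import Defs.
From mathcomp Require Import all_boot all_order all_algebra.
From mathcomp Require Import reals boolp ring.
From mathcomp.real_closed Require Import complex mxtens.

Set Implicit Arguments.
Unset Strict Implicit.
Unset Printing Implicit Defensive.

Import Order.TTheory GRing.Theory Num.Theory.
Local Open Scope ring_scope.
Local Open Scope sesquilinear_scope.

(* Sufficiency is an energy balance: for unitary W the block operator
   Delta(W) = sum_k E_k (x) W_k preserves H (x) 1, so the Stein equation makes f(W)
   J-isometric wherever the pencil is invertible.

   For necessity, z = l (1 + x) / (1 - x) with a suitable |l| = 1 turns the given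
   node into one that is regular at x = 0 and whose transfer function t is
   J-unitary at all small skew-Hermitian tuples.  Evaluating at signed adjacency
   matrices of coloured paths extracts from this, for every word w,
     sum_{w = u v} (-1)^|u| t(rev u)^* J t(v) = [w = 1] J.
   These identities say that the Gram form forced on the reachable states by the
   Lyapunov equations S A + A^* S = C^* J C, S B = C^* J D is well defined and
   Hermitian.  Controllability thus yields a block diagonal S, observability its
   invertibility, and H = 2 S solves the Stein equation of the original node. *)

(** * Fractions attached to rational expressions *)

(** The obstacle is that f is a series at 0, while unitarity lives on tuples of unitary matrices,
    away from 0. The Cayley transform moves the expansion point to (l, ..., l); l must avoid the
    zeros of det(1 - z A) and of the denominators of chosen expressions for the entries of f, so
    that the new node and f are both regular there. Unitary tuples become skew-Hermitian ones, which
    form a real vector space: along a ray s Y with s real, J-unitarity is, after clearing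
    denominators, a polynomial identity in s, whose coefficients can be compared at s = 0. Since the
    adjoint of Y^u is (-1)^|u| Y^(rev u), the signs and reversals of the word identity come from
    adjoints. No limits occur: polynomial identities are tested at natural numbers, which are
    infinitely many and fixed by conjugation. The factor 2 in H comes from (1 - a)^* S (1 + a) + (1
    + a)^* S (1 - a) = 2 (S - a^* S a) with a = l A. *)

Section PolyMatrix.
Variable K : fieldType.

Definition coefmx p q k (A : 'M[{poly K}]_(p, q)) : 'M[K]_(p, q) :=
  map_mx (coefp k) A.

(** Congruence modulo ['X^m]. Power series occur only through their truncations [trunc], and
    congruences for all m give equality of polynomials. *)
Definition eqmodX m p q (A B : 'M[{poly K}]_(p, q)) :=
  forall k, (k < m)%N -> coefmx k A = coefmx k B.

Definition trunc m p q (c : nat -> 'M[K]_(p, q)) : 'M[{poly K}]_(p, q) :=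
  \matrix_(i, j) \poly_(k < m) c k i j.

Definition evmx p q (t : K) (A : 'M[{poly K}]_(p, q)) : 'M[K]_(p, q) :=
  map_mx (horner_eval t) A.

Lemma coefmxM p q s k (A : 'M_(p, q)) (B : 'M_(q, s)) :
  coefmx k (A *m B) = \sum_(i < k.+1) coefmx i A *m coefmx (k - i) B.
Proof.
apply/matrixP => x y; rewrite !mxE summxE /=.
rewrite coef_sum (eq_bigr _ (fun z _ => coefM (A x z) (B z y) k)).
rewrite exchange_big; apply: eq_bigr => i _; rewrite !mxE.
by apply: eq_bigr => z _; rewrite !mxE.
Qed.

Lemma coefmxD p q k (A B : 'M_(p, q)) : coefmx k (A + B) = coefmx k A + coefmx k B.
Proof. by apply/matrixP => x y; rewrite !mxE /= coefD. Qed.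

Lemma coefmxZ p q k (d : {poly K}) (A : 'M_(p, q)) :
  coefmx k (d *: A) = \sum_(i < k.+1) d`_i *: coefmx (k - i) A.
Proof.
apply/matrixP => x y; rewrite !mxE summxE /= coefM.
by apply: eq_bigr => i _; rewrite !mxE.
Qed.

Lemma coef_trunc m p q (c : nat -> 'M[K]_(p, q)) k :
  (k < m)%N -> coefmx k (trunc m c) = c k.
Proof. by move=> km; apply/matrixP => x y; rewrite !mxE /= coef_poly km. Qed.

Lemma eqmodX_trans m p q (A B D : 'M_(p, q)) :
  eqmodX m A B -> eqmodX m B D -> eqmodX m A D.
Proof. by move=> AB BD k km; rewrite AB ?BD. Qed.

Lemma eqmodX_sym m p q (A B : 'M_(p, q)) : eqmodX m A B -> eqmodX m B A.
Proof. by move=> AB k km; rewrite AB. Qed.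

Lemma eqmodXD m p q (A B A' B' : 'M_(p, q)) :
  eqmodX m A A' -> eqmodX m B B' -> eqmodX m (A + B) (A' + B').
Proof. by move=> eA eB k km; rewrite !coefmxD eA ?eB. Qed.

Lemma eqmodXM m p q s (A A' : 'M_(p, q)) (B B' : 'M_(q, s)) :
  eqmodX m A A' -> eqmodX m B B' -> eqmodX m (A *m B) (A' *m B').
Proof.
move=> eA eB k km; rewrite !coefmxM; apply: eq_bigr => i _.
have ik : (i < m)%N by rewrite (leq_ltn_trans _ km) // -ltnS.
by rewrite eA ?eB // (leq_ltn_trans _ km) // leq_subr.
Qed.

Lemma eqmodXZ m p q d (A B : 'M_(p, q)) :
  eqmodX m A B -> eqmodX m (d *: A) (d *: B).
Proof.
move=> eA k km; rewrite !coefmxZ; apply: eq_bigr => i _.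
by rewrite eA // (leq_ltn_trans _ km) // leq_subr.
Qed.

(** A polynomial with non-zero constant term is invertible as a power series. *)
Lemma eqmodXZ_inj m p q (d : {poly K}) (A B : 'M_(p, q)) :
  d`_0 != 0 -> eqmodX m (d *: A) (d *: B) -> eqmodX m A B.
Proof.
move=> d0 e k; elim/ltn_ind: k => k IH km.
have := e k km; rewrite !coefmxZ !big_ord_recl /= subn0.
under eq_bigr => i _.
  rewrite IH; first over.
    by rewrite /= /bump /= add1n -subn_gt0 subKn ?ltn_ord // .
  by rewrite (leq_ltn_trans _ km) // leq_subr.
by move/addIr/(scalerI d0).
Qed.

Lemma eqmodXP p q (A B : 'M_(p, q)) : (forall m, eqmodX m A B) -> A = B.
Proof.
move=> e; apply/matrixP => i j; apply/polyP => k.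
by have /matrixP/(_ i j) := e k.+1 k (ltnSn k); rewrite !mxE.
Qed.

Lemma truncM m p q s (c : nat -> 'M_(p, q)) (d : nat -> 'M_(q, s)) :
  eqmodX m (trunc m (fun k => \sum_(i < k.+1) c i *m d (k - i)%N))
           (trunc m c *m trunc m d).
Proof.
move=> k km; rewrite coefmxM coef_trunc //; apply: eq_bigr => i _.
rewrite !coef_trunc // (leq_ltn_trans _ km) ?leq_subr //.
by rewrite -ltnS.
Qed.

Lemma eq_trunc m p q (c d : nat -> 'M_(p, q)) : c =1 d -> trunc m c = trunc m d.
Proof.
by move=> e; apply/matrixP => i j; rewrite !mxE; apply: eq_poly => k _; rewrite e.
Qed.

Lemma truncD m p q (c d : nat -> 'M_(p, q)) :
  trunc m (fun k => c k + d k) = trunc m c + trunc m d.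
Proof.
apply/matrixP => i j; rewrite !mxE; apply/polyP => k.
by rewrite coefD !coef_poly !mxE; case: ifP => // _; rewrite addr0.
Qed.

Lemma evmxM t p q s (A : 'M_(p, q)) (B : 'M_(q, s)) :
  evmx t (A *m B) = evmx t A *m evmx t B.
Proof. exact: map_mxM. Qed.

Lemma evmxD t p q (A B : 'M_(p, q)) : evmx t (A + B) = evmx t A + evmx t B.
Proof. exact: map_mxD. Qed.

Lemma evmxZ t p q d (A : 'M_(p, q)) : evmx t (d *: A) = d.[t] *: evmx t A.
Proof. exact: map_mxZ. Qed.

Lemma evmx1 t n : evmx t (1%:M : 'M_n) = 1%:M.
Proof. exact: map_mx1. Qed.

Lemma det_evmx t n (A : 'M_n) : \det (evmx t A) = (\det A).[t].
Proof. by rewrite det_map_mx. Qed.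

Lemma adj_evmx t n (A : 'M_n) : evmx t (\adj A) = \adj (evmx t A).
Proof. by rewrite /evmx map_mx_adj. Qed.

Lemma evmxC t p q (A : 'M_(p, q)) : evmx t (map_mx polyC A) = A.
Proof. by apply/matrixP => i j; rewrite !mxE /horner_eval hornerC. Qed.

Lemma coefmxC p q k (A : 'M_(p, q)) :
  coefmx k (map_mx polyC A) = if k is 0 then A else 0.
Proof.
by apply/matrixP => i j; rewrite !mxE /= coefC; case: k => [|k]; rewrite ?mxE.
Qed.

End PolyMatrix.

Section RationalExpression.
Variables (K : fieldType) (N : nat).
Implicit Types (e : ncrat K N) (f g : seq 'I_N -> K).

(** Numerator matrix and scalar denominator after substituting [Z k] / [dl k]. Nothing is cancelled:
    the inverse of P/d is written d^2 adj P / (d det P), so that the denominator vanishes also where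
    P/d itself is undefined. *)
Fixpoint ncrat_frac n (Z : 'I_N -> 'M[{poly K}]_n) (dl : 'I_N -> {poly K}) e :
    'M[{poly K}]_n * {poly K} :=
  match e with
  | NCConst c => (c%:P%:M, 1)
  | NCVar i => (Z i, dl i)
  | NCAdd e1 e2 =>
      let p1 := ncrat_frac Z dl e1 in let p2 := ncrat_frac Z dl e2 in
      (p2.2 *: p1.1 + p1.2 *: p2.1, p1.2 * p2.2)
  | NCMul e1 e2 =>
      let p1 := ncrat_frac Z dl e1 in let p2 := ncrat_frac Z dl e2 in
      (p1.1 *m p2.1, p1.2 * p2.2)
  | NCInv e1 =>
      let p1 := ncrat_frac Z dl e1 in (p1.2 ^+ 2 *: \adj p1.1, p1.2 * \det p1.1)
  end.

Lemma ncrat_frac_eval n (Z : 'I_N -> 'M[{poly K}]_n) dl t (ZZ : 'I_N -> 'M[K]_n) e :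
  (forall k, (dl k).[t] != 0) ->
  (forall k, evmx t (Z k) = (dl k).[t] *: ZZ k) ->
  let p := ncrat_frac Z dl e in
  ncrat_defined ZZ e = (p.2.[t] != 0) /\
  (ncrat_defined ZZ e -> evmx t p.1 = p.2.[t] *: ncrat_eval ZZ e).
Proof.
move=> dl0 ZE /=.
elim: e => [c|i|e1 [d1 v1] e2 [d2 v2]|e1 [d1 v1] e2 [d2 v2]|e1 [d1 v1]] /=.
- rewrite hornerE oner_eq0; split=> // _.
  by rewrite scale1r /evmx map_scalar_mx /= /horner_eval hornerE.
- by rewrite dl0.
- split; first by rewrite hornerM mulf_eq0 negb_or d1 d2.
  case/andP=> /v1 e1E /v2 e2E; rewrite evmxD !evmxZ e1E e2E hornerM scalerDr !scalerA.
  by rewrite mulrC.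
- split; first by rewrite hornerM mulf_eq0 negb_or d1 d2.
  case/andP=> /v1 e1E /v2 e2E; rewrite evmxM e1E e2E hornerM.
  by rewrite -scalemxAl -scalemxAr scalerA.
- split.
    rewrite hornerM mulf_eq0 negb_or d1; case: (boolP (_ != 0)) => //= dn0.
    rewrite -det_evmx v1 ?d1 // detZ mulf_eq0 negb_or expf_neq0 //=.
    by rewrite unitmxE unitfE.
  case/andP=> de1 ue1; rewrite evmxZ adj_evmx horner_exp.
  have := v1 de1; set P := evmx _ _ => PE; rewrite hornerM -det_evmx -/P.
  rewrite -[LHS](mulmxK ue1) -scalemxAl expr2 -!scalerA.
  by rewrite scalemxAr -PE mul_adj_mx -scalemxAl mul_scalar_mx scalerA.
Qed.

(** The homogeneous component of degree k: the sum of f_w W^w over words w of length k. *)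
Fixpoint hcoef n (W : 'I_N -> 'M[K]_n) f k : 'M[K]_n :=
  if k is k'.+1 then \sum_i W i *m hcoef W (fun w => f (i :: w)) k'
  else (f [::])%:M.

Lemma eq_hcoef n (W : 'I_N -> 'M[K]_n) f g : f =1 g -> hcoef W f =1 hcoef W g.
Proof.
move=> e k; elim: k f g e => [|k IH] f g e /=; first by rewrite e.
by apply: eq_bigr => i _; rewrite (IH _ (fun w => g (i :: w))).
Qed.

Lemma hcoef0 n (W : 'I_N -> 'M[K]_n) k : hcoef W (fun=> 0) k = 0.
Proof.
elim: k => [|k IH] /=; first by rewrite raddf0.
by apply: big1 => i _; rewrite IH mulmx0.
Qed.

Lemma hcoefD n (W : 'I_N -> 'M[K]_n) f g k :
  hcoef W (fun w => f w + g w) k = hcoef W f k + hcoef W g k.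
Proof.
elim: k f g => [|k IH] f g /=; first by rewrite raddfD.
by rewrite -big_split; apply: eq_bigr => i _; rewrite IH mulmxDr.
Qed.

Lemma hcoefZ n (W : 'I_N -> 'M[K]_n) a g k :
  hcoef W (fun w => a * g w) k = a *: hcoef W g k.
Proof.
elim: k g => [|k IH] g /=; first by rewrite scale_scalar_mx.
by rewrite scaler_sumr; apply: eq_bigr => i _; rewrite IH scalemxAr.
Qed.

Lemma hcoefM n (W : 'I_N -> 'M[K]_n) f g k :
  hcoef W (fps_mul f g) k = \sum_(i < k.+1) hcoef W f i *m hcoef W g (k - i).
Proof.
elim: k f g => [|k IH] f g /=.
  by rewrite big_ord1 /= /fps_mul big_ord1 /= scalar_mxM.
rewrite big_ord_recl /= mul_scalar_mx scaler_sumr.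
under [X in _ + X]eq_bigr do rewrite mulmx_suml.
rewrite exchange_big /= -big_split; apply: eq_bigr => i _ /=.
(* Leibniz rule for removing a first letter i from a product: either f contributes the empty word,
   or i is taken from f. *)
rewrite (@eq_hcoef _ _ _
  (fun w => f [::] * g (i :: w) + fps_mul (fun w => f (i :: w)) g w)); last first.
  by move=> w; rewrite {1}/fps_mul big_ord_recl.
rewrite hcoefD hcoefZ IH mulmxDr scalemxAr; congr (_ + _).
by rewrite mulmx_sumr; apply: eq_bigr => j _; rewrite mulmxA.
Qed.

Lemma hcoef_const n (W : 'I_N -> 'M[K]_n) c k :
  hcoef W (fps_const c) k = if k is 0 then c%:M else 0.
Proof.
by case: k => //= k; apply: big1 => i _; rewrite hcoef0 mulmx0.
Qed.

Lemma hcoef_var n (W : 'I_N -> 'M[K]_n) i k :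
  hcoef W (fps_var K i) k = if k == 1%N then W i else 0.
Proof.
case: k => [|k] /=; first by rewrite /fps_var raddf0.
rewrite (bigD1 i) //= big1 ?addr0 => [|j ji]; last first.
  rewrite (@eq_hcoef _ _ _ (fun=> 0)) ?hcoef0 ?mulmx0 // => w.
  by rewrite /fps_var eqseq_cons (negbTE ji).
rewrite (@eq_hcoef _ _ _ (fps_const 1)); last first.
  by move=> w; rewrite /fps_var eqseq_cons eqxx; case: w.
by rewrite hcoef_const; case: k => [|k]; rewrite ?mulmx1 ?mulmx0.
Qed.

(* Along the path Z = tW the fraction attached to e expands, as a power series in
   t, to the homogeneous components of the represented series. *)
Lemma ncrat_frac_series n (W : 'I_N -> 'M[K]_n) e f m :
  represents e f ->
  let p := ncrat_frac (fun k => 'X *: map_mx polyC (W k)) (fun=> 1) e in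
  eqmodX m (p.2 *: trunc m (hcoef W f)) p.1.
Proof.
move=> /= ; elim: e f => [c|i|e1 IH1 e2 IH2|e1 IH1 e2 IH2|e1 IH1] f /=.
- move=> fE k km; rewrite scale1r coef_trunc // (eq_hcoef _ fE) hcoef_const.
  by rewrite -map_scalar_mx coefmxC.
- move=> fE k km; rewrite scale1r coef_trunc // (eq_hcoef _ fE) hcoef_var.
  apply/matrixP => x y; rewrite !mxE /= coefXM coefC.
  by case: k km => [|[|k]] km; rewrite ?mxE.
- case=> f1 [f2 [/IH1 e1E /IH2 e2E fE]].
  rewrite (eq_trunc _ (eq_hcoef W fE)) (eq_trunc _ (hcoefD W f1 f2)) truncD scalerDr.
  rewrite mulrC -[in X in eqmodX _ (X + _) _]scalerA mulrC -scalerA.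
  by apply: eqmodXD; apply: eqmodXZ.
- case=> f1 [f2 [/IH1 e1E /IH2 e2E fE]].
  rewrite (eq_trunc _ (eq_hcoef W fE)) (eq_trunc _ (hcoefM W f1 f2)).
  apply: eqmodX_trans (eqmodXM e1E e2E).
  by rewrite -scalemxAl -scalemxAr scalerA; apply/eqmodXZ/truncM.
- case=> f1 [/IH1 e1E f10 ff1 _]; set P := (ncrat_frac _ _ e1) in e1E *.
  have one : eqmodX m (trunc m (hcoef W f1) *m trunc m (hcoef W f)) 1%:M.
    apply: eqmodX_trans (eqmodX_sym (truncM _ _)) _ => k km.
    rewrite coef_trunc // -hcoefM (eq_hcoef _ ff1) hcoef_const.
    by rewrite -(map_mx1 polyC) coefmxC.
  have {}e1E : eqmodX m (P.1 *m trunc m (hcoef W f)) (P.2 *: 1%:M).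
    apply: eqmodX_trans (eqmodXM (eqmodX_sym e1E) (fun=> _)) _ => //.
    by rewrite -scalemxAl; apply: eqmodXZ.
  rewrite -scalerA expr2 -scalerA; apply: eqmodXZ.
  rewrite -mul_scalar_mx -mul_adj_mx -mulmxA -[X in eqmodX _ _ (_ *: X)]mulmx1.
  by rewrite scalemxAr; apply: eqmodXM.
Qed.

(** The inversions allowed by [represents] have non-zero constant term, so none fails at 0. This
    makes common denominators non-zero polynomials. *)
Lemma ncrat_eval0 n e f : represents e f ->
  ncrat_defined (fun=> 0 : 'M[K]_n) e /\
  ncrat_eval (fun=> 0 : 'M[K]_n) e = (f [::])%:M.
Proof.
elim: e f => [c|i|e1 IH1 e2 IH2|e1 IH1 e2 IH2|e1 IH1] f /=.
- by move=> ->.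
- by move=> ->; rewrite /fps_var raddf0.
- case=> f1 [f2 [/IH1 [-> ->] /IH2 [-> ->] ->]].
  by rewrite /fps_add raddfD.
- case=> f1 [f2 [/IH1 [-> ->] /IH2 [-> ->] ->]].
  by rewrite /fps_mul big_ord1 /= scalar_mxM.
- case=> f1 [/IH1 [-> ->] f10 /(_ [::]) + _].
  rewrite /fps_mul big_ord1 /= => ff1.
  have u : ((f1 [::])%:M : 'M[K]_n) \in unitmx.
    by rewrite unitmxE det_scalar unitfE expf_neq0.
  by split=> //; rewrite -[RHS](mulKmx u) -scalar_mxM ff1 mulmx1.
Qed.

(** Scalar matrices compute like scalars, so a point l found with 1 by 1 matrices serves for path
    matrices of every size. *)
Lemma ncrat_eval_scalar (t : K) e :
  ncrat_defined (fun=> t%:M : 'M[K]_1) e ->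
  exists x, forall n, ncrat_defined (fun=> t%:M : 'M[K]_n) e /\
    ncrat_eval (fun=> t%:M : 'M[K]_n) e = x%:M.
Proof.
elim: e => [c|i|e1 IH1 e2 IH2|e1 IH1 e2 IH2|e1 IH1] /=.
- by exists c.
- by exists t.
- case/andP=> /IH1 [x xE] /IH2 [y yE]; exists (x + y) => n.
  by have [-> ->] := xE n; have [-> ->] := yE n; rewrite raddfD.
- case/andP=> /IH1 [x xE] /IH2 [y yE]; exists (x * y) => n.
  by have [-> ->] := xE n; have [-> ->] := yE n; rewrite scalar_mxM.
- case/andP=> /IH1 [x xE]; have [_ ->] := xE 1%N.
  rewrite unitmxE det_scalar1 unitfE => x0; exists x^-1 => n.
  have [-> ->] := xE n.
  have u : (x%:M : 'M[K]_n) \in unitmx.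
    by rewrite unitmxE det_scalar unitfE expf_neq0.
  by split=> //; rewrite -[RHS](mulKmx u) -scalar_mxM divff ?mulmx1.
Qed.

End RationalExpression.

(** * Substitution of matrices in a state space realization *)

Section TensorBlocks.
Variable R : comPzRingType.

Definition blk q s n (V : 'M[R]_(q * n, s * n)) i j : 'M[R]_n :=
  \matrix_(a, b) V (mxtens_index (i, a)) (mxtens_index (j, b)).

Lemma blkP q s n (V V' : 'M[R]_(q * n, s * n)) :
  (forall i j, blk V i j = blk V' i j) -> V = V'.
Proof.
move=> e; apply/matrixP => x y.
case: (mxtens_indexP x) => i a; case: (mxtens_indexP y) => j b.
by have /matrixP/(_ a b) := e i j; rewrite !mxE.
Qed.

Lemma sum_mxtens q n (F : 'I_(q * n) -> R) :
  \sum_z F z = \sum_i \sum_a F (mxtens_index (i, a)).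
Proof.
rewrite pair_big (reindex (@mxtens_index q n)) /=; last first.
  by exists (@mxtens_unindex q n) => x _; rewrite (mxtens_indexK, mxtens_unindexK).
by apply: eq_bigr => -[].
Qed.

Lemma blkM p q s n (U : 'M_(p * n, q * n)) (V : 'M_(q * n, s * n)) i j :
  blk (U *m V) i j = \sum_k blk U i k *m blk V k j.
Proof.
apply/matrixP => a b; rewrite !mxE summxE sum_mxtens; apply: eq_bigr => k _.
by rewrite !mxE; apply: eq_bigr => c _; rewrite !mxE.
Qed.

Lemma blk_tens q s n (A : 'M_(q, s)) (W : 'M_n) i j :
  blk (A *t W) i j = A i j *: W.
Proof. by apply/matrixP => a b; rewrite !mxE !mxtens_indexK. Qed.

Lemma tensmxDl p q n s (A B : 'M[R]_(p, q)) (W : 'M_(n, s)) :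
  (A + B) *t W = A *t W + B *t W.
Proof. by apply/matrixP => x y; rewrite !mxE mulrDl. Qed.

Lemma tensmxDr p q n s (A : 'M[R]_(p, q)) (W W' : 'M_(n, s)) :
  A *t (W + W') = A *t W + A *t W'.
Proof. by apply/matrixP => x y; rewrite !mxE mulrDr. Qed.

Lemma tensmxZl p q n s a (A : 'M[R]_(p, q)) (W : 'M_(n, s)) :
  (a *: A) *t W = a *: (A *t W).
Proof. by apply/matrixP => x y; rewrite !mxE mulrA. Qed.

Lemma tensmxZr p q n s a (A : 'M[R]_(p, q)) (W : 'M_(n, s)) :
  A *t (a *: W) = a *: (A *t W).
Proof. by apply/matrixP => x y; rewrite !mxE mulrCA. Qed.

Lemma tensmx11 p n : (1%:M : 'M[R]_p) *t (1%:M : 'M_n) = 1%:M.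
Proof.
apply: blkP => i j; rewrite blk_tens; apply/matrixP => a b; rewrite !mxE.
by rewrite (inj_eq (can_inj (@mxtens_indexK _ _))) xpair_eqE -natrM mulnb.
Qed.

Definition lift1 n p q (A : 'M[R]_(p, q)) : 'M_(p * n, q * n) :=
  A *t (1%:M : 'M_n).

Lemma lift1M n p q s (A : 'M_(p, q)) (B : 'M_(q, s)) :
  lift1 n (A *m B) = lift1 n A *m lift1 n B.
Proof. by rewrite /lift1 tensmx_mul mulmx1. Qed.

Lemma lift1D n p q (A B : 'M_(p, q)) :
  lift1 n (A + B) = lift1 n A + lift1 n B.
Proof. exact: tensmxDl. Qed.

Lemma lift1Z n p q a (A : 'M_(p, q)) : lift1 n (a *: A) = a *: lift1 n A.
Proof. exact: tensmxZl. Qed.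

Lemma lift1N n p q (A : 'M_(p, q)) : lift1 n (- A) = - lift1 n A.
Proof. by rewrite -scaleN1r lift1Z scaleN1r. Qed.

Lemma lift11 n p : lift1 n (1%:M : 'M_p) = 1%:M.
Proof. exact: tensmx11. Qed.

Lemma lift1_inj n p q (A B : 'M_(p, q)) :
  (0 < n)%N -> lift1 n A = lift1 n B -> A = B.
Proof.
case: n => // n _ e; apply/matrixP => i j.
have := congr1 (fun V => blk V i j 0 0) e.
by rewrite /= !blk_tens !mxE !mulr1.
Qed.

End TensorBlocks.

Section StateSpace.
Variables (K : fieldType) (N r q : nat) (E : 'I_N -> 'M[K]_r).
Variables (A : 'M[K]_r) (B : 'M[K]_(r, q)) (C : 'M[K]_(q, r)) (D : 'M[K]_q).

(** The block structure is carried by the matrices [E k], later the block projections, so that all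
    products have a fixed size: the block A_jk of a node becomes E_j A E_k. *)
Fixpoint state (w : seq 'I_N) : 'M[K]_(r, q) :=
  if w is k :: w' then A *m E k *m state w' else B.

Definition transfer (w : seq 'I_N) : 'M[K]_q :=
  if w is k :: w' then C *m E k *m state w' else D.

Section Substitution.
Variable n : nat.
Implicit Types W : 'I_N -> 'M[K]_n.

Fixpoint mcoef W p s (g : seq 'I_N -> 'M[K]_(p, s)) k : 'M[K]_(p * n, s * n) :=
  if k is k'.+1 then \sum_i (1%:M *t W i) *m mcoef W (fun w => g (i :: w)) k'
  else lift1 n (g [::]).

Lemma mcoef_mull W p s u (X : 'M_(u, p)) (g : seq 'I_N -> 'M_(p, s)) k :
  mcoef W (fun w => X *m g w) k = lift1 n X *m mcoef W g k.
Proof.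
elim: k g => [|k IH] g /=; first by rewrite lift1M.
rewrite mulmx_sumr; apply: eq_bigr => i _; rewrite IH !mulmxA; congr (_ *m _).
by rewrite /lift1 !tensmx_mul !mulmx1 !mul1mx.
Qed.

Lemma blk_mcoef W p s (g : seq 'I_N -> 'M_(p, s)) k i j :
  blk (mcoef W g k) i j = hcoef W (fun w => g w i j) k.
Proof.
elim: k g => [|k IH] g /=; first by rewrite blk_tens scalemx1.
rewrite (_ : blk _ i j = \sum_l blk ((1%:M *t W l) *m
  mcoef W (fun w => g (l :: w)) k) i j); last first.
  apply/matrixP => a b; rewrite !mxE !summxE; apply: eq_bigr => l _.
  by rewrite [RHS]mxE.
apply: eq_bigr => l _; rewrite blkM (bigD1 i) //= big1 ?addr0 => [|k' ki].
  by rewrite blk_tens mxE eqxx scale1r IH.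
by rewrite blk_tens mxE eq_sym (negbTE ki) scale0r mul0mx.
Qed.

Definition delta W : 'M[K]_(r * n) := \sum_k E k *t W k.

Lemma mcoef_state W k :
  mcoef W state k.+1 = lift1 n A *m delta W *m mcoef W state k.
Proof.
rewrite /= -mulmxA mulmx_suml mulmx_sumr; apply: eq_bigr => i _.
by rewrite mcoef_mull !mulmxA /lift1 !tensmx_mul !mul1mx !mulmx1.
Qed.

Lemma mcoef_transfer W k :
  mcoef W transfer k.+1 = lift1 n C *m delta W *m mcoef W state k.
Proof.
rewrite /= -mulmxA mulmx_suml mulmx_sumr; apply: eq_bigr => i _.
by rewrite mcoef_mull !mulmxA /lift1 !tensmx_mul !mul1mx !mulmx1.
Qed.

Definition pencil W : 'M[{poly K}]_(r * n) :=
  1%:M - 'X *: map_mx polyC (lift1 n A *m delta W).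

(** Cramer's rule: the numerator of the transfer function along t W, over the denominator
    [\det (pencil W)]. *)
Definition transfer_num W : 'M[{poly K}]_(q * n) :=
  \det (pencil W) *: map_mx polyC (lift1 n D) +
  'X *: (map_mx polyC (lift1 n C *m delta W) *m
         (\adj (pencil W) *m map_mx polyC (lift1 n B))).

(** X stands for Delta(Z). As [invmx] is total, this is the transfer function only where the
    inverted matrix is a unit. *)
Definition transfer_at (X : 'M[K]_(r * n)) : 'M[K]_(q * n) :=
  lift1 n D + lift1 n C *m X *m invmx (1%:M - lift1 n A *m X) *m lift1 n B.

Lemma coefmxXZ p s k (M : 'M[{poly K}]_(p, s)) :
  coefmx k ('X *: M) = if k is k'.+1 then coefmx k' M else 0.
Proof.
by apply/matrixP => x y; rewrite !mxE /= coefXM; case: k => [|k]; rewrite ?mxE.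
Qed.

Lemma coefmxCM p s u k (X : 'M[K]_(p, s)) (M : 'M[{poly K}]_(s, u)) :
  coefmx k (map_mx polyC X *m M) = X *m coefmx k M.
Proof.
rewrite coefmxM big_ord_recl big1 => [|i _]; last by rewrite coefmxC mul0mx.
by rewrite addr0 coefmxC subn0.
Qed.

Lemma transfer_num_series W m :
  eqmodX m (\det (pencil W) *: trunc m (mcoef W transfer)) (transfer_num W).
Proof.
(* Telescoping by [mcoef_state]: the state series solves the linear system of the pencil with
   right-hand side B. *)
have stE : eqmodX m (pencil W *m trunc m (mcoef W state)) (map_mx polyC (lift1 n B)).
  move=> k km; rewrite /pencil mulmxBl mul1mx -scaleN1r -scalemxAl coefmxD.
  rewrite -[-1]/(- 1%:P) -polyCN coefmxZ big_ord_recl big1 => [|i _]; last first.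
    by rewrite coefC scale0r.
  rewrite addr0 coefC /= subn0 scaleN1r coefmxXZ coefmxC coef_trunc //.
  case: k km => [|k] km; first by rewrite subr0.
  by rewrite coefmxCM coef_trunc 1?ltnW // mcoef_state subrr.
have tfE : eqmodX m (trunc m (mcoef W transfer)) (map_mx polyC (lift1 n D) +
    'X *: (map_mx polyC (lift1 n C *m delta W) *m trunc m (mcoef W state))).
  move=> k km; rewrite coef_trunc // coefmxD coefmxC coefmxXZ.
  case: k km => [|k] km; first by rewrite addr0.
  by rewrite add0r coefmxCM coef_trunc 1?ltnW // mcoef_transfer.
apply: eqmodX_trans (eqmodXZ _ tfE) _; rewrite scalerDr; apply: eqmodXD => //.
rewrite scalerA mulrC -scalerA; apply: eqmodXZ; rewrite scalemxAr.
apply: eqmodXM => //.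
rewrite -mul_scalar_mx -mul_adj_mx -mulmxA; exact: eqmodXM.
Qed.

Lemma det_pencil W t :
  (\det (pencil W)).[t] = \det (1%:M - lift1 n A *m (t *: delta W)).
Proof.
by rewrite -det_evmx /pencil /evmx map_mxB map_mx1 map_mxZ -/(evmx t _) evmxC
  /= /horner_eval hornerX scalemxAr.
Qed.

Lemma transfer_num_eval W t : (\det (pencil W)).[t] != 0 ->
  evmx t (transfer_num W) = (\det (pencil W)).[t] *: transfer_at (t *: delta W).
Proof.
move=> d0; have d0' : \det (1%:M - lift1 n A *m (t *: delta W)) != 0.
  by rewrite -det_pencil.
rewrite /transfer_num evmxD !evmxZ !evmxM !evmxC hornerX /transfer_at.
rewrite scalerDr; congr (_ + _).
rewrite adj_evmx {1}/pencil /evmx map_mxB map_mx1 map_mxZ -/(evmx t _) evmxC.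
rewrite /= /horner_eval hornerX scalemxAr /invmx unitmxE unitfE d0' det_pencil.
set U := \adj _; set d := \det _ in d0' *.
by rewrite -!mulmxA -!(scalemxAl, scalemxAr) !scalerA mulrCA divff // mulr1.
Qed.

(** Whatever expressions witness f(W), their fractions along t W have the same Taylor series at t =
    0 as the transfer function, so the cross-multiplied polynomials agree; then t = 1 is
    substituted. *)
Lemma value_transfer W V : fps_value transfer W V ->
  \det (1%:M - lift1 n A *m delta W) != 0 -> V = transfer_at (delta W).
Proof.
move=> fV d0; apply: blkP => i j.
have [e [re de eE]] := fV i j.
have /= := @ncrat_frac_eval _ _ _ (fun k => 'X *: map_mx polyC (W k)) (fun=> 1) 1 W e.
set p := ncrat_frac _ _ _; case => [k|k|pd /(_ de) pE].
- by rewrite hornerE oner_neq0.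
- by rewrite evmxZ evmxC hornerX hornerE.
have p0 : p.2.[1] != 0 by rewrite -pd.
have dp : \det (pencil W) *: p.1 = p.2 *: blk (transfer_num W) i j.
  apply: eqmodXP => m; have /= pm := @ncrat_frac_series _ _ _ W e _ m re.
  apply: eqmodX_trans (eqmodXZ _ (eqmodX_sym pm)) _.
  rewrite scalerA mulrC -scalerA; apply: eqmodXZ => k km.
  have /matrixP tE := transfer_num_series W km.
  apply/matrixP => a b; have := tE (mxtens_index (i, a)) (mxtens_index (j, b)).
  rewrite !mxE /= => <-.
  rewrite (@eq_poly _ _ (fun l => hcoef W (fps_entry transfer i j) l a b)
    (fun l => mcoef W transfer l (mxtens_index (i, a)) (mxtens_index (j, b)))) // =>
    l _.
  by rewrite -blk_mcoef mxE.
have := congr1 (evmx 1) dp; rewrite !evmxZ pE.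
have -> : evmx 1 (blk (transfer_num W) i j) = blk (evmx 1 (transfer_num W)) i j.
  by apply/matrixP => a b; rewrite !mxE.
have d1 : (\det (pencil W)).[1] != 0 by rewrite det_pencil scale1r.
rewrite transfer_num_eval // scale1r.
have -> (a : K) (U : 'M_(q * n)) : blk (a *: U) i j = a *: blk U i j.
  by apply/matrixP => x y; rewrite !mxE.
by rewrite !scalerA mulrC eE => /(scalerI (mulf_neq0 p0 d1)).
Qed.

End Substitution.
End StateSpace.

(** * Controllability *)

Lemma cayley_mxE (K : fieldType) r (a : 'M[K]_r) : 1%:M - a \in unitmx ->
  (1%:M + a) *m invmx (1%:M - a) = 2%:R *: invmx (1%:M - a) - 1%:M.
Proof.
move=> ua; rewrite (_ : 1%:M + a = 2%:R *: 1%:M - (1%:M - a)).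
  by rewrite mulmxBl mulmxV // -scalemxAl mul1mx.
by rewrite scaler_nat mulr2n opprB addrACA subrr addr0.
Qed.

Section Controllability.
Variable K : fieldType.

(* A linear combination of the g w of maximal rank already spans all of them. *)
Lemma column_span_projector r q (T : Type) (g : T -> 'M[K]_(r, q)) :
  exists s : seq (T * 'M[K]_(q, r)), forall w,
    (\sum_(p <- s) g p.1 *m p.2) *m g w = g w.
Proof.
pose P (s : seq (T * 'M[K]_(q, r))) := \sum_(p <- s) g p.1 *m p.2.
have PM s Z : P [seq (p.1, p.2 *m Z) | p <- s] = P s *m Z.
  by rewrite /P big_map mulmx_suml; apply: eq_bigr => p _; rewrite mulmxA.
pose rk n := `[< exists s, \rank (P s) = n >].
have rk0 : exists n, rk n by exists (\rank (P [::])); apply/asboolP; exists [::].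
have rkle n : rk n -> (n <= r)%N by move=> /asboolP[s <-]; exact: rank_leq_row.
have [n /asboolP[s sn] nmax] := ex_maxnP rk0 rkle.
set X := P s in sn; exists [seq (p.1, p.2 *m pinvmx X) | p <- s] => w.
rewrite -/(P _) PM -/X.
suff /submxP[Z gZ] : ((g w)^T <= X^T)%MS.
  have -> : g w = X *m Z^T by apply: trmx_inj; rewrite gZ trmx_mul trmxK.
  by rewrite mulmxA mulmxKpV.
(* If X did not span the columns of [g w], appending w to s with a suitable coefficient would give a
   combination of larger rank. *)
pose M := (X^T + (g w)^T)%MS.
have [Y YE] : exists Y, M = Y *m col_mx X^T (g w)^T by apply/submxP; rewrite -addsmxE.
have ME : M^T = P ((w, (rsubmx Y)^T) :: [seq (p.1, p.2 *m (lsubmx Y)^T) | p <- s]).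
  rewrite YE -{1}(hsubmxK Y) mul_row_col linearD /= !trmx_mul !trmxK addrC.
  by rewrite -PM /P big_cons.
have : (\rank M <= \rank X^T)%N.
  rewrite mxrank_tr sn; apply: nmax; rewrite /rk; apply/asboolP.
  by exists ((w, (rsubmx Y)^T) :: [seq (p.1, p.2 *m (lsubmx Y)^T) | p <- s]);
    rewrite -ME mxrank_tr.
have XM : (X^T <= M)%MS by exact: addsmxSl.
rewrite (geq_leqif (mxrank_leqif_sup XM)) => MX.
by apply: submx_trans MX; exact: addsmxSr.
Qed.

Variables (N r q : nat) (E : 'I_N -> 'M[K]_r).
Hypothesis EE : forall i j, E i *m E j = if i == j then E i else 0.
Hypothesis sumE : \sum_k E k = 1%:M.

(** Blockwise reachability: the columns of the projected states span the range of each E_k. The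
    explicit coefficients serve both to cancel states, as in [controllable_inj], and to define S
    from its values on them. *)
Definition controllable (A : 'M_r) (B : 'M_(r, q)) :=
  forall k, exists s : seq (seq 'I_N * 'M_(q, r)),
    \sum_(p <- s) E k *m state E A B p.1 *m p.2 = E k.

Lemma controllable_inj A B m (X Y : 'M_(m, r)) : controllable A B ->
  (forall k w, X *m (E k *m state E A B w) = Y *m (E k *m state E A B w)) -> X = Y.
Proof.
move=> cAB XY; rewrite -[X]mulmx1 -[Y]mulmx1 -sumE !mulmx_sumr.
apply: eq_bigr => k _; have [s <-] := cAB k.
by rewrite !mulmx_sumr; apply: eq_bigr => p _; rewrite !(mulmxA _ _ p.2) XY.
Qed.

(* The reachable subspace of the transformed pair is invariant under G, hence under
   its inverse, and so it contains the reachable subspace of (A, B). *)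
Lemma controllable_cayley A B l m : controllable A B ->
  (2%:R : K) != 0 -> l != 0 -> m != 0 ->
  1%:M - l *: A \in unitmx ->
  let G := invmx (1%:M - l *: A) in
  controllable ((1%:M + l *: A) *m G) (m *: (G *m B)).
Proof.
move=> cAB two0 l0 m0 uF G; set A' := _ *m G; set B' := m *: _.
set F := 1%:M - l *: A in uF G A' B' *.
pose st' := state E A' B'.
have /fin_all_exists[s sP] k := column_span_projector (fun w => E k *m st' w).
pose P k := \sum_(p <- s k) E k *m st' p.1 *m p.2.
have {}sP k w : P k *m (E k *m st' w) = E k *m st' w by exact: sP.
have EP k : E k *m P k = P k.
  rewrite /P mulmx_sumr; apply: eq_bigr => p _.
  by rewrite !mulmxA EE eqxx.
(* Projector, commuting with every E_k, onto the sum over k of the spans of the E_k st' w. *)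
pose Q := \sum_k P k *m E k.
have EQ k : E k *m Q = P k *m E k.
  rewrite /Q mulmx_sumr (bigD1 k) //= mulmxA EP big1 ?addr0 // => j jk.
  by rewrite -EP !mulmxA EE eq_sym (negbTE jk) !mul0mx.
have QE k : Q *m E k = P k *m E k.
  rewrite /Q mulmx_suml (bigD1 k) //= -mulmxA EE eqxx big1 ?addr0 // => j jk.
  by rewrite -mulmxA EE (negbTE jk) mulmx0.
have Qdef : Q = \sum_k P k *m E k by [].
have PEdef k : P k *m E k = \sum_(p <- s k) E k *m st' p.1 *m (p.2 *m E k).
  by rewrite /P mulmx_suml; apply: eq_bigr => p _; rewrite !mulmxA.
clearbody Q P.
have Qst' k w : Q *m (E k *m st' w) = E k *m st' w.
  by rewrite mulmxA QE -mulmxA -{2}[E k *m _]sP; congr (_ *m _);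
     rewrite mulmxA -[E k in LHS]mulmx1.
have Qst w : Q *m st' w = st' w.
  have -> : st' w = \sum_k E k *m st' w by rewrite -mulmx_suml sumE mul1mx.
  by rewrite mulmx_sumr; apply: eq_bigr.
have QAP : Q *m (A' *m Q) = A' *m Q.
  have -> : A' *m Q = \sum_k A' *m (P k *m E k) by rewrite Qdef mulmx_sumr.
  rewrite mulmx_sumr; apply: eq_bigr => k _.
  rewrite PEdef !mulmx_sumr; apply: eq_bigr => p _.
  have -> : A' *m (E k *m st' p.1 *m (p.2 *m E k)) = st' (k :: p.1) *m (p.2 *m E k).
    by rewrite /= !mulmxA.
  by rewrite mulmxA Qst.
have QQ : Q *m Q = Q.
  rewrite {2 3}Qdef mulmx_sumr; apply: eq_bigr => k _.
  rewrite PEdef !mulmx_sumr; apply: eq_bigr => p _.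
  by rewrite mulmxA Qst'.
have A'E : A' = 2%:R *: G - 1%:M by exact: cayley_mxE.
have QG : Q *m (G *m Q) = G *m Q.
  have -> : G = 2%:R^-1 *: (A' + 1%:M).
    by rewrite A'E subrK scalerA mulVf // scale1r.
  by rewrite -scalemxAl -scalemxAr mulmxDl mul1mx mulmxDr QAP QQ.
have uG : G \in unitmx by rewrite unitmx_inv.
(* G maps the range of Q into itself and is injective, so by dimension onto it; hence its inverse F
   preserves that range too. *)
have QF : Q *m (F *m Q) = F *m Q.
  have /submxP[Y YE] : (Q^T <= (G *m Q)^T)%MS.
    have le : ((G *m Q)^T <= Q^T)%MS by rewrite -QG trmx_mul submxMl.
    by rewrite -(geq_leqif (mxrank_leqif_sup le)) [(G *m Q)^T]trmx_mul mxrankMfree //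
      row_free_unit unitmx_tr.
  have -> : F *m Q = Q *m Y^T.
    by apply: trmx_inj; rewrite trmx_mul YE !trmx_mul trmxK -!mulmxA -trmx_mul
     mulmxV ?trmx1 ?mulmx1.
  by rewrite mulmxA QQ.
have QA : Q *m (A *m Q) = A *m Q.
  have -> : A = l^-1 *: (1%:M - F) by rewrite /F subKr scalerA mulVf // scale1r.
  by rewrite -scalemxAl -scalemxAr mulmxBl mul1mx mulmxBr QF QQ.
have QGB : Q *m (G *m B) = G *m B.
  have := Qst [::]; rewrite /st' /= /B' -scalemxAr => /(scalerI m0).
  by [].
have QB : Q *m B = B.
  rewrite -[B in LHS](mulKVmx uF) -/G -[X in F *m X]QGB 2!mulmxA.
  by rewrite -(mulmxA Q) QF -mulmxA QGB mulmxA mulmxV // mul1mx.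
have Qw w : Q *m state E A B w = state E A B w.
  elim: w => //= k w IH.
  rewrite -{1}IH -(mulmxA A) (mulmxA (E k)) EQ -QE -(mulmxA Q).
  by rewrite !(mulmxA A) !mulmxA -(mulmxA Q) QA -!mulmxA (mulmxA Q) QE -EQ
     -(mulmxA (E k)) IH.
have QE1 k : Q *m E k = E k.
  have [t tE] := cAB k; rewrite -{2}tE -{1}tE mulmx_sumr; apply: eq_bigr => p _.
  by rewrite !mulmxA QE -EQ -(mulmxA (E k)) Qw.
move=> k; exists [seq (p.1, p.2 *m E k) | p <- s k].
by rewrite big_map -[RHS]QE1 QE PEdef.
Qed.

End Controllability.

(** * Minimal nodes *)

Section Nodes.
Variables (K : fieldType) (N q : nat).
Implicit Types (al be : GR_node K N q) (f : seq 'I_N -> 'M[K]_q) (d : 'I_N -> nat).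

Lemma mul_mxdiag d (U V : forall k, 'M[K]_(d k)) :
  \mxdiag_k U k *m \mxdiag_k V k = \mxdiag_k (U k *m V k).
Proof.
rewrite [X in _ *m X]/mxdiag mul_mxdiag_mxblock; apply/eq_mxblock => i j.
by case: eqVneq => [->|]; rewrite ?conform_mx_id ?mulmx0.
Qed.

Definition bproj d k : 'M[K]_(\sum_j d j) :=
  \mxdiag_j ((j == k)%:R%:M : 'M_(d j)).

Lemma mulmx_bproj d p (X : 'M_(p, \sum_j d j)) k :
  X *m bproj d k = \mxrow_j ((j == k)%:R *: submxrow X j).
Proof.
rewrite -{1}(submxrowK X) mul_mxrow_mxdiag; apply: eq_mxrow => j.
by rewrite mul_mx_scalar.
Qed.

Lemma bproj_mulmx d p (X : 'M_(\sum_j d j, p)) k :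
  bproj d k *m X = \mxcol_j ((j == k)%:R *: submxcol X j).
Proof.
rewrite -{1}(submxcolK X) mul_mxdiag_mxcol; apply: eq_mxcol => j.
by rewrite mul_scalar_mx.
Qed.

Lemma bprojM d i j : bproj d i *m bproj d j = if i == j then bproj d i else 0.
Proof.
rewrite mul_mxdiag; case: (eqVneq i j) => [<-|ij].
  by apply: eq_mxdiag => k; rewrite -scalar_mxM -natrM mulnb andbb.
rewrite -mxdiag0; apply: eq_mxdiag => k; rewrite -scalar_mxM -natrM mulnb.
by case: eqVneq => [->|]; rewrite ?(negbTE ij) ?raddf0.
Qed.

Lemma sum_bproj d : \sum_k bproj d k = 1%:M.
Proof.
rewrite -mxdiagZ /bproj -mxdiag_sum; apply: eq_mxdiag => j.
rewrite (bigD1 j) //= eqxx big1 ?addr0 // => k kj.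
by rewrite eq_sym (negbTE kj) raddf0.
Qed.

Lemma tr_bproj d k : (bproj d k)^T = bproj d k.
Proof. by rewrite tr_mxdiag; apply: eq_mxdiag => j; rewrite tr_scalar_mx. Qed.

Lemma bproj_mxdiagC d (U : forall k, 'M[K]_(d k)) k :
  bproj d k *m \mxdiag_j U j = \mxdiag_j U j *m bproj d k.
Proof.
rewrite !mul_mxdiag; apply: eq_mxdiag => j.
by rewrite mul_scalar_mx mul_mx_scalar.
Qed.

Lemma bproj_comm_mxdiag d (H : 'M_(\sum_k d k)) :
  (forall k, bproj d k *m H = H *m bproj d k) ->
  H = \mxdiag_k submxblock H k k.
Proof.
move=> HE; rewrite -{1}(submxblockK H); apply/eq_mxblock => i j.
case: eqVneq => [->|ij]; first by rewrite conform_mx_id.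
have <- : submxblock (bproj d i *m H) i j = submxblock H i j.
  by rewrite bproj_mulmx !submxblockEv mxcolK eqxx scale1r.
rewrite HE mulmx_bproj submxblockEh mxrowK eq_sym (negbTE ij) scale0r.
by apply/matrixP => a b; rewrite !mxE.
Qed.

Lemma submxrow_submxcol d p s (X : 'M_(p, \sum_j d j)) (Y : 'M_(\sum_j d j, s)) k :
  submxrow X k *m submxcol Y k = X *m bproj d k *m Y.
Proof.
rewrite mulmx_bproj -{2}(submxcolK Y) mul_mxrow_mxcol (bigD1 k) //=.
rewrite eqxx scale1r big1 ?addr0 // => j jk.
by rewrite (negbTE jk) scale0r mul0mx.
Qed.

Definition gr_statemx al := state (bproj (gr_dim al)) (gr_A al) (gr_B al).

Lemma gr_stateE al j w : gr_state al j w = submxcol (gr_statemx al w) j.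
Proof.
elim: w j => //= k w IH j; rewrite IH submxblockEv submxrow_submxcol.
by rewrite -!submxcol_mul.
Qed.

Lemma gr_transferE al :
  gr_transfer al =1
  transfer (bproj (gr_dim al)) (gr_A al) (gr_B al) (gr_C al) (gr_D al).
Proof. by case=> //= k w; rewrite gr_stateE submxrow_submxcol. Qed.

(* Compressing every C^{r_k} to the span of its reachable states gives another
   realization of f. *)
Lemma minimal_controllable al f : minimal_gr_realization al f ->
  controllable (bproj (gr_dim al)) (gr_A al) (gr_B al).
Proof.
case=> alf almin.
have /fin_all_exists[s sP] k := column_span_projector (gr_state al k).
pose P k := \sum_(p <- s k) gr_state al k p.1 *m p.2.
pose L k := row_base (P k); pose Q k := col_base (P k).
have QL k w : Q k *m (L k *m gr_state al k w) = gr_state al k w.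
  by rewrite mulmxA mulmx_base sP.
clearbody L Q.
pose be := @GRNode K N q (fun k => \rank (P k))
  (\mxblock_(i, j) (L i *m submxblock (gr_A al) i j *m Q j))
  (\mxcol_j (L j *m submxcol (gr_B al) j))
  (\mxrow_j (submxrow (gr_C al) j *m Q j)) (gr_D al).
have beE j w : gr_state be j w = L j *m gr_state al j w.
  elim: w j => [|k w IH] j /=; first by rewrite mxcolK.
  by rewrite mxblockK IH -!mulmxA QL.
have bef : gr_realization be f.
  move=> w; rewrite -alf; case: w => //= k w.
  by rewrite beE mxrowK -mulmxA QL.
(* [P k] is idempotent, and minimality forces it to have full rank. *)
have P1 k : P k = 1%:M.
  have rP : (gr_dim al k <= \rank (P k))%N by exact: (almin be bef k).
  have uP : P k \in unitmx by rewrite -row_free_unit -row_leq_rank.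
  rewrite -[LHS]mulmx1 -(mulmxV uP) mulmxA; congr (_ *m _).
  rewrite {2}/P mulmx_sumr; apply: eq_bigr => p _.
  by rewrite mulmxA sP.
move=> k; exists [seq (p.1, p.2 *m submxcol 1%:M k) | p <- s k].
rewrite big_map /=.
transitivity (submxrow 1%:M k *m P k *m submxcol 1%:M k :> 'M[K]_(\sum_j gr_dim al j)).
  2: by rewrite P1 mulmx1 submxrow_submxcol mul1mx mulmx1.
rewrite /P mulmx_sumr mulmx_suml; apply: eq_bigr => p _.
rewrite gr_stateE -[gr_statemx al p.1 in RHS]mul1mx submxcol_mul.
by rewrite !mulmxA submxrow_submxcol !mul1mx !mulmxA.
Qed.

(** The dual node: it realizes the series with words reversed and coefficients transposed, and turns
    observability into controllability. *)
Definition gr_tr al : GR_node K N q :=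
  @GRNode K N q (gr_dim al) (gr_A al)^T (gr_C al)^T (gr_B al)^T (gr_D al)^T.

Lemma transfer_tr r (E : 'I_N -> 'M[K]_r) A B C (D : 'M_q) w :
  (forall k, (E k)^T = E k) ->
  transfer E A^T C^T B^T D^T w = (transfer E A B C D (rev w))^T.
Proof.
move=> ET; case: w => //= k v.
(* Pairing a dual state with a state glues their words, the dual one reversed; [catrev] follows this
   recursion. *)
have st_tr j u x : (state E A^T C^T u)^T *m E j *m state E A B x =
    transfer E A B C D (catrev u (j :: x)).
  elim: u j x => [|i u IH] j x /=; first by rewrite trmxK.
  by rewrite -IH /= !trmx_mul !trmxK ET !mulmxA.
by rewrite /rev -[catrev _ _]/(catrev v [:: k]) -st_tr !trmx_mul trmxK ET mulmxA.
Qed.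

Lemma gr_tr_realization al f : gr_realization al f ->
  gr_realization (gr_tr al) (fun w => (f (rev w))^T).
Proof.
move=> alf w; rewrite -alf !gr_transferE.
by apply: transfer_tr; exact: tr_bproj.
Qed.

Lemma minimal_observable al f : minimal_gr_realization al f ->
  controllable (bproj (gr_dim al)) (gr_A al)^T (gr_C al)^T.
Proof.
case=> alf almin.
apply: (@minimal_controllable (gr_tr al) (fun w => (f (rev w))^T)).
split=> [|be bef k]; first exact: gr_tr_realization.
apply: (almin (gr_tr be)) => w.
by rewrite (gr_tr_realization bef) revK trmxK.
Qed.

End Nodes.

(** * The Lyapunov equations *)

Section ConjugateTranspose.
Variable F : numClosedFieldType.

Lemma ctmxM m n p (X : 'M[F]_(m, n)) (Y : 'M_(n, p)) :
  (X *m Y)^t* = Y^t* *m X^t*.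
Proof. by rewrite trmx_mul map_mxM. Qed.

Lemma ctmxD m n (X Y : 'M[F]_(m, n)) : (X + Y)^t* = X^t* + Y^t*.
Proof. by rewrite linearD map_mxD. Qed.

Lemma ctmxN m n (X : 'M[F]_(m, n)) : (- X)^t* = - X^t*.
Proof. by rewrite linearN map_mxN. Qed.

Lemma ctmxZ m n a (X : 'M[F]_(m, n)) : (a *: X)^t* = a^* *: X^t*.
Proof. by rewrite linearZ map_mxZ. Qed.

Lemma ctmx1 n : (1%:M : 'M[F]_n)^t* = 1%:M.
Proof. by rewrite trmx1 map_mx1. Qed.

Lemma ctmx0 m n : (0 : 'M[F]_(m, n))^t* = 0.
Proof. by rewrite trmx0 map_mx0. Qed.

Lemma ctmxK m n (X : 'M[F]_(m, n)) : X^t*^t* = X.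
Proof. by apply/matrixP => i j; rewrite !mxE conjCK. Qed.

Lemma ctmx_inj m n (X Y : 'M[F]_(m, n)) : X^t* = Y^t* -> X = Y.
Proof. by move=> e; rewrite -[X]ctmxK e ctmxK. Qed.

Lemma ctmx_sum m n (I : finType) (X : I -> 'M[F]_(m, n)) :
  (\sum_i X i)^t* = \sum_i (X i)^t*.
Proof. by apply: (big_morph (fun Y => Y^t*)) => [Y Z|]; rewrite ?ctmxD ?ctmx0. Qed.

End ConjugateTranspose.

Section Lyapunov.
Variables (F : numClosedFieldType) (N r q : nat) (E : 'I_N -> 'M[F]_r).
Hypothesis EE : forall i j, E i *m E j = if i == j then E i else 0.
Hypothesis sumE : \sum_k E k = 1%:M.
Hypothesis ctE : forall k, (E k)^t* = E k.
Variables (A : 'M[F]_r) (B : 'M[F]_(r, q)) (C : 'M[F]_(q, r)) (D J : 'M[F]_q).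
Hypothesis ctJ : J^t* = J.

Local Notation st := (state E A B).
Local Notation tf := (transfer E A B C D).

(* What S *m st w has to be if S solves the Lyapunov equations. *)
Fixpoint costate (w : seq 'I_N) : 'M[F]_(r, q) :=
  if w is k :: w' then C^t* *m J *m tf w - A^t* *m E k *m costate w'
  else C^t* *m J *m D.

(** Unfolding [costate] moves k onto v and puts the first letter of w in its place. Iterated, this
    writes the Gram form as an alternating sum over factorizations of a word. *)
Lemma costate_gram k v w :
  (st v)^t* *m E k *m costate w =
  (tf (k :: v))^t* *m J *m tf w -
    (if w is j :: w' then (st (k :: v))^t* *m E j *m costate w' else 0).
Proof.
have tE : (st v)^t* *m E k *m C^t* = (tf (k :: v))^t* by rewrite /= !ctmxM ctE mulmxA.
have sE : (st v)^t* *m E k *m A^t* = (st (k :: v))^t* by rewrite /= !ctmxM ctE mulmxA.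
by case: w => [|j w] /=; rewrite ?mulmxBr -tE -?sE !mulmxA ?subr0.
Qed.

Hypothesis gram0 : forall k w, B^t* *m E k *m costate w = D^t* *m J *m tf (k :: w).

(** Induction on v, with [gram0] as the base case. Under controllability, symmetry makes every
    linear relation among the E_k st v hold for the E_k costate v as well. *)
Lemma costate_gram_sym k v w :
  (st v)^t* *m E k *m costate w = ((st w)^t* *m E k *m costate v)^t*.
Proof.
have ctXJ (X Y : 'M_q) : (X^t* *m J *m Y)^t* = Y^t* *m J *m X.
  by rewrite !ctmxM ctmxK ctJ mulmxA.
elim: v k w => [|j v IH] k w.
  by rewrite [in RHS]costate_gram subr0 gram0 ctXJ.
rewrite [in RHS]costate_gram ctmxD ctmxN -IH [in RHS]costate_gram.
by rewrite ctXJ opprB addrC subrK.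
Qed.

Lemma lyapunov_solution : controllable E A B ->
  exists S : 'M[F]_r, [/\ S^t* = S, forall k, E k *m S = S *m E k,
    S *m A + A^t* *m S = C^t* *m J *m C & S *m B = C^t* *m J *m D].
Proof.
move=> cAB; have /fin_all_exists[s sE] := cAB.
(* Writing E_k as a combination of states forces S E_k to be the same combination of costates. *)
pose T k := \sum_(p <- s k) E k *m costate p.1 *m (p.2 *m E k).
have ET k : E k *m T k = T k.
  rewrite /T mulmx_sumr; apply: eq_bigr => p _.
  by rewrite !mulmxA EE eqxx.
have TE k : T k *m E k = T k.
  rewrite /T mulmx_suml; apply: eq_bigr => p _.
  by rewrite -!mulmxA EE eqxx.
(* Symmetry removes the dependence of [T k] on the chosen combination. *)
have stT u k : (st u)^t* *m T k = (costate u)^t* *m E k.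
  transitivity ((costate u)^t* *m E k *m E k); last by rewrite -mulmxA EE eqxx.
  rewrite -[X in _ *m X *m E k]sE !(mulmx_sumr, mulmx_suml); apply: eq_bigr => p _.
  by rewrite !mulmxA costate_gram_sym !ctmxM ctE ctmxK !mulmxA.
pose S := \sum_k T k.
have ES k : E k *m S = T k.
  rewrite /S mulmx_sumr (bigD1 k) //= ET big1 ?addr0 // => j jk.
  by rewrite -ET mulmxA EE eq_sym (negbTE jk) mul0mx.
have SE k : S *m E k = T k.
  rewrite /S mulmx_suml (bigD1 k) //= TE big1 ?addr0 // => j jk.
  by rewrite -TE -mulmxA EE (negbTE jk) mulmx0.
clearbody S T.
have Sst k v : S *m (E k *m st v) = E k *m costate v.
  apply: ctmx_inj; apply: (controllable_inj sumE cAB) => j u.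
  apply: ctmx_inj; rewrite !ctmxM !ctmxK !ctE.
  rewrite !mulmxA -(mulmxA _ (E j) S) ES stT -!mulmxA !(mulmxA (E j)) EE.
  case: eqP => _; last by rewrite !mul0mx !mulmx0.
  by rewrite !mulmxA costate_gram_sym !ctmxM ctE ctmxK !mulmxA.
have SstE k w : S *m st (k :: w) = costate (k :: w).
  rewrite -[st _]mul1mx -[RHS]mul1mx -sumE !mulmx_suml mulmx_sumr.
  by apply: eq_bigr => j _; exact: Sst.
have S0 : S *m B = C^t* *m J *m D.
  rewrite -[B]mul1mx -[RHS]mul1mx -sumE !mulmx_suml mulmx_sumr.
  by apply: eq_bigr => j _; exact: (Sst j [::]).
exists S; split=> // [|k|].
- apply: (controllable_inj sumE cAB) => k w; rewrite Sst.
  apply: ctmx_inj; rewrite !ctmxM !ctmxK !ctE.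
  by rewrite -mulmxA ES stT.
- by rewrite ES SE.
- apply: (controllable_inj sumE cAB) => k w.
  rewrite mulmxDl -!(mulmxA _ S) Sst -(mulmxA S) (mulmxA A) -/(st (k :: w)) SstE.
  by rewrite /= !mulmxA subrK.
Qed.

(** The kernel of S lies in that of C, because D^* J C = B^* S with D^* J invertible; hence it is
    invariant under A, and under each E_k by commutation. It is thus contained in the unobservable
    subspace, which is zero. *)
Lemma lyapunov_unit S : controllable E A^T C^T -> (forall k, (E k)^T = E k) ->
  J *m J = 1%:M -> D^t* *m J *m D = J ->
  S^t* = S -> (forall k, E k *m S = S *m E k) ->
  S *m A + A^t* *m S = C^t* *m J *m C -> S *m B = C^t* *m J *m D ->
  S \in unitmx.
Proof.
move=> cAC ET JJ DJD ctS ES SA SB.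
have uD : D^t* *m J \in unitmx.
  have : D^t* *m J *m D \in unitmx by rewrite DJD; case: (mulmx1_unit JJ).
  by rewrite unitmx_mul => /andP[].
have CX m (X : 'M_(r, m)) : S *m X = 0 -> C *m X = 0.
  move=> SX; apply: (can_inj (mulKmx uD)); rewrite mulmx0 mulmxA.
  have -> : D^t* *m J *m C = B^t* *m S.
    by apply: ctmx_inj; rewrite !ctmxM !ctmxK ctJ ctS SB mulmxA.
  by rewrite -mulmxA SX mulmx0.
have AX m (X : 'M_(r, m)) : S *m X = 0 -> S *m (A *m X) = 0.
  move=> SX; have := congr1 (fun Y => Y *m X) SA.
  by rewrite /= mulmxDl -!mulmxA SX CX // !mulmx0 addr0.
have stX m w (X : 'M_(r, m)) : S *m X = 0 -> (state E A^T C^T w)^T *m X = 0.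
  elim: w X => [|k w IH] X SX /=; first by rewrite trmxK CX.
  rewrite !trmx_mul trmxK ET -!mulmxA; apply: IH.
  by rewrite (mulmxA S) -ES -mulmxA AX ?mulmx0.
have X0 m (X : 'M_(r, m)) : S *m X = 0 -> X = 0.
  move=> SX; apply: trmx_inj; rewrite trmx0.
  apply: (controllable_inj sumE cAC) => k w; rewrite mul0mx.
  apply: trmx_inj; rewrite trmx0 !trmx_mul ET trmxK -mulmxA; apply: stX.
  by rewrite (mulmxA S) -ES -mulmxA SX mulmx0.
have /X0/(congr1 mxrank) : S *m cokermx S = 0 by exact: mulmx_coker.
rewrite mxrank0 mxrank_coker => /eqP; rewrite subn_eq0 => rS.
by rewrite -row_free_unit -row_leq_rank.
Qed.

End Lyapunov.

(** * Extraction of the coefficients of a word *)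

Section PathMatrices.
Variable F : numClosedFieldType.

(** Slicing complementary to [blk]: a sum of f_w (x) Y^w is sent to the sum of the (Y^w)_xy f_w. *)
Definition fib q s n (V : 'M[F]_(q * n, s * n)) x y : 'M[F]_(q, s) :=
  \matrix_(a, b) V (mxtens_index (a, x)) (mxtens_index (b, y)).

Lemma fibM p q s n (U : 'M_(p * n, q * n)) (V : 'M_(q * n, s * n)) x y :
  fib (U *m V) x y = \sum_z fib U x z *m fib V z y.
Proof.
apply/matrixP => a b; rewrite !mxE summxE sum_mxtens exchange_big /=.
apply: eq_bigr => z _.
by rewrite !mxE; apply: eq_bigr => c _; rewrite !mxE.
Qed.

Lemma fib_tens q s n (A : 'M_(q, s)) (W : 'M_n) x y :
  fib (A *t W) x y = W x y *: A.
Proof. by apply/matrixP => a b; rewrite !mxE !mxtens_indexK mulrC. Qed.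

Lemma fib_sum q s n (I : finType) (V : I -> 'M_(q * n, s * n)) x y :
  fib (\sum_i V i) x y = \sum_i fib (V i) x y.
Proof.
by apply/matrixP => a b; rewrite !mxE !summxE; apply: eq_bigr => i _; rewrite mxE.
Qed.

Lemma fib_ct q s n (V : 'M_(q * n, s * n)) x y :
  fib (V^t*) x y = (fib V y x)^t*.
Proof. by apply/matrixP => a b; rewrite !mxE. Qed.

Lemma fib0 q s n x y : fib (0 : 'M_(q * n, s * n)) x y = 0.
Proof. by apply/matrixP => a b; rewrite !mxE. Qed.

Variables (N q : nat) (w : seq 'I_N).
Implicit Type f : seq 'I_N -> 'M[F]_q.

(* The signed adjacency matrices of the path 0 - 1 - ... - size w whose edge
   {x, x + 1} is coloured by the x-th letter of w.  A monomial of degree size w has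
   a non-zero (0, size w) entry only if it is w itself, since the path must then be
   walked straight from one end to the other. *)
Definition path_mx k : 'M[F]_((size w).+1) :=
  \matrix_(x, y) (((y == x.+1 :> nat) && (nth k w x == k))%:R
                  - ((x == y.+1 :> nat) && (nth k w y == k))%:R).

Lemma ct_path_mx k : (path_mx k)^t* = - path_mx k.
Proof. by apply/matrixP => x y; rewrite !mxE rmorphB /= !rmorph_nat opprB. Qed.

Lemma fib_mcoefS f j x y :
  fib (mcoef path_mx f j.+1) x y =
  \sum_i \sum_z path_mx i x z *: fib (mcoef path_mx (fun u => f (i :: u)) j) z y.
Proof.
rewrite /= fib_sum; apply: eq_bigr => i _; rewrite fibM; apply: eq_bigr => z _.
by rewrite fib_tens -scalemxAl mul1mx.
Qed.

(** The last vertex is size w - x steps away from x; a walk of exactly that length only moves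
    forward and reads the suffix of w, and a shorter one cannot arrive. *)
Lemma fib_mcoef_max f j (x : 'I_(size w).+1) : (x + j <= size w)%N ->
  fib (mcoef path_mx f j) x ord_max =
  if (x + j)%N == size w then f (drop x w) else 0.
Proof.
elim: j f x => [|j IH] f x xj.
  rewrite fib_tens mxE addn0; case: eqVneq => [->|xm] /=.
    by rewrite eqxx scale1r drop_size.
  rewrite scale0r; case: eqP => // e; case/eqP: xm; exact: val_inj.
have xw : (x < size w)%N by rewrite (leq_trans _ xj) // addnS ltnS leq_addr.
pose x1 : 'I_(size w).+1 := Ordinal (xw : (x.+1 < (size w).+1)%N).
pose c := tnth (in_tuple w) (Ordinal xw).
(* In [path_mx] the default of [nth] is the colour itself, but it is never returned, since x < size
   w. *)
have cE i : nth i w x = c by rewrite /c (tnth_nth i).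
rewrite fib_mcoefS (bigD1 c) //= [X in _ + X]big1 ?addr0 => [|i ic]; last first.
  apply: big1 => z _; rewrite mxE.
  case: (eqVneq (x : nat) z.+1) => [xz|xz] /=.
    rewrite IH ?xz ?addSn; last first.
      by rewrite xz addnS addSn in xj; rewrite -ltnS ltnW // ltnS ltnW.
    by rewrite ifN ?scaler0 //; rewrite xz addnS addSn in xj; rewrite neq_ltn ltnW.
  by rewrite cE eq_sym [c == i]eq_sym (negbTE ic) andbF subr0 scale0r.
rewrite (bigD1 x1) //= big1 ?addr0 => [|z zx]; last first.
  rewrite mxE; case: (eqVneq (x : nat) z.+1) => [xz|xz] /=.
    rewrite IH; last by rewrite xz addnS addSn in xj; rewrite ltnW // ltnW.
    by rewrite ifN ?scaler0 //; rewrite xz addnS addSn in xj; rewrite neq_ltn ltnW.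
  case: (eqVneq (z : nat) x.+1) => [e|e]; last by rewrite subrr scale0r.
  by case/eqP: zx; apply: val_inj.
rewrite mxE /= eqxx cE eqxx /= [_ == x.+2 :> nat]ltn_eqF; last by rewrite ltnW.
rewrite subr0 scale1r IH /= ?addSnnS // ; case: eqP => // _.
by rewrite (drop_nth c xw) cE.
Qed.

(** Descending from z to 0 reads a prefix of w backwards, and each edge contributes -1. *)
Lemma fib_mcoef_min f j (z : 'I_(size w).+1) : (j <= z)%N ->
  fib (mcoef path_mx f j) z ord0 =
  if j == z then (-1) ^+ z *: f (rev (take z w)) else 0.
Proof.
elim: j f z => [|j IH] f z jz.
  rewrite fib_tens mxE; case: (eqVneq z ord0) => [->|z0] /=.
    by rewrite take0 expr0.
  by rewrite scale0r eq_sym (_ : (z == 0%N :> nat) = false) //; apply: negbTE.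
case: z jz => -[|y] yw //= jy; have {}jy : (j <= y)%N by [].
have yw' : (y < size w)%N by [].
pose y1 : 'I_(size w).+1 := Ordinal (ltnW yw).
pose c := tnth (in_tuple w) (Ordinal yw').
have cE i : nth i w y = c by rewrite /c (tnth_nth i).
have up i (x : 'I_(size w).+1) : x = y.+2 :> nat ->
    fib (mcoef path_mx (fun u => f (i :: u)) j) x ord0 = 0.
  move=> xy; rewrite IH ?xy; last by rewrite ltnW // ltnW.
  by rewrite ltn_eqF // ltnW.
rewrite fib_mcoefS (bigD1 c) //= [X in _ + X]big1 ?addr0 => [|i ic]; last first.
  apply: big1 => x _; rewrite mxE /=.
  case: (eqVneq (x : nat) y.+2) => [/up->|xy] /=; first by rewrite scaler0.
  case: (eqVneq y.+1 x.+1) => [[<-]|_] /=; last by rewrite subrr scale0r.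
  by rewrite cE [c == i]eq_sym (negbTE ic) subrr scale0r.
rewrite (bigD1 y1) //= big1 ?addr0 => [|x xy]; last first.
  rewrite mxE /=; case: (eqVneq (x : nat) y.+2) => [/up->|_] /=.
    by rewrite scaler0.
  case: (eqVneq y.+1 x.+1) => [[e]|_] /=; last by rewrite subrr scale0r.
  by case/eqP: xy; apply: val_inj.
rewrite mxE /= eqxx cE eqxx ltn_eqF // sub0r IH //= eqSS.
case: eqP => // _; last by rewrite scaler0.
by rewrite scalerA exprS mulN1r (take_nth c yw') cE rev_rcons.
Qed.

(** An intermediate vertex z contributes only if i steps lead from z down to 0 and m - i steps from
    z up to m, which forces z = i. *)
Lemma path_mx_extract (J : 'M[F]_q) f (m := size w) :
  fib (\sum_(i < m.+1) (mcoef path_mx f i)^t* *m lift1 m.+1 J *m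
         mcoef path_mx f (m - i)) ord0 ord_max =
  \sum_(z < m.+1) (-1) ^+ z *: ((f (rev (take z w)))^t* *m J *m f (drop z w)).
Proof.
rewrite fib_sum; apply: eq_bigr => i _.
have im : (i <= m)%N by rewrite -ltnS.
rewrite fibM (bigD1 i) //= big1 ?addr0 => [|z zi].
  rewrite fibM (bigD1 i) //= big1 ?addr0 => [|z zi]; last first.
    by rewrite fib_tens mxE (negbTE zi) scale0r mulmx0.
  rewrite fib_tens mxE eqxx scale1r fib_ct fib_mcoef_min // eqxx.
  rewrite fib_mcoef_max ?subnKC // eqxx ctmxZ rmorphXn rmorphN1.
  by rewrite -!scalemxAl.
have [lt|ge] := ltnP i z.
  rewrite fibM big1 ?mul0mx // => y _.
  rewrite fib_tens mxE; case: eqVneq => [->|_]; last by rewrite scale0r mulmx0.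
  by rewrite fib_ct fib_mcoef_min 1?ltnW // ltn_eqF // ctmx0 mul0mx.
have zi' : (z < i)%N by rewrite ltn_neqAle ge andbT.
have zm : (z + (m - i) < m)%N by rewrite -[X in (_ < X)%N](subnKC im) ltn_add2r.
rewrite [X in _ *m X]fib_mcoef_max; last exact: ltnW.
by rewrite ltn_eqF // mulmx0.
Qed.

End PathMatrices.

Section WordIdentity.
Variables (F : numClosedFieldType) (N r q : nat) (E : 'I_N -> 'M[F]_r).
Hypothesis ctE : forall k, (E k)^t* = E k.
Variables (A : 'M[F]_r) (B : 'M[F]_(r, q)) (C : 'M[F]_(q, r)) (D J : 'M[F]_q).

Hypothesis series_unitary : forall n (Y : 'I_N -> 'M[F]_n), (0 < n)%N ->
  (forall k, (Y k)^t* = - Y k) -> forall k,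
  \sum_(i < k.+1) (mcoef Y (transfer E A B C D) i)^t* *m lift1 n J *m
    mcoef Y (transfer E A B C D) (k - i) = if k is 0 then lift1 n J else 0.

Lemma feedthrough_unitary : D^t* *m J *m D = J.
Proof.
have := series_unitary (n := 1) (Y := fun=> 0) isT _ 0.
rewrite big_ord1 /= /lift1 => /(_ _) e; apply: (@lift1_inj _ 1) => //.
rewrite !lift1M -[RHS]e; last by move=> k; rewrite ctmx0 oppr0.
congr (_ *m _ *m _); apply/matrixP => x y; rewrite !mxE rmorphM /=.
by congr (_ * _); rewrite rmorph_nat eq_sym.
Qed.

(** The word k w is non-empty, so its alternating sum vanishes; splitting off the term z = 0 gives
    the claim. *)
Lemma costate_gram0 k w :
  B^t* *m E k *m costate E A B C D J w = D^t* *m J *m transfer E A B C D (k :: w).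
Proof.
set t := transfer E A B C D.
(* s holds the letters already moved to the left factor, in reverse order; [phi [::] u] is the sum
   extracted by [path_mx_extract]. *)
pose phi s u := \sum_(z < (size u).+1)
  (-1) ^+ z *: ((t (catrev (take z u) s))^t* *m J *m t (drop z u)).
have phiS s j u : phi s (j :: u) = (t s)^t* *m J *m t (j :: u) - phi (j :: s) u.
  rewrite /phi big_ord_recl expr0 scale1r; congr (_ + _).
  rewrite -sumrN; apply: eq_bigr => z _ /=.
  by rewrite exprS mulN1r scaleNr.
have gramE v u j : (state E A B v)^t* *m E j *m costate E A B C D J u = phi (j :: v) u.
  elim: u v j => [|i u IH] v j; rewrite costate_gram //.
    by rewrite /phi big_ord1 expr0 scale1r subr0.
  by rewrite phiS IH.
have p0 : phi [::] (k :: w) = 0.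
  rewrite [phi _ _](esym (path_mx_extract (k :: w) J t)) series_unitary ?fib0 // => i.
  exact: ct_path_mx.
apply/eqP; rewrite -[B]/(state E A B [::]) gramE eq_sym -subr_eq0.
by rewrite -[D]/(t [::]) -phiS p0.
Qed.

End WordIdentity.

(** * Points of evaluation and the Cayley transform *)

Section PointsOfEvaluation.
Variable F : numClosedFieldType.

(** In characteristic 0 the product p g has more roots than its size allows; g collects the
    exceptional points. *)
Lemma poly_nat_eq0 (p g : {poly F}) : g != 0 ->
  (forall k : nat, g.[k%:R] != 0 -> p.[k%:R] = 0) -> p = 0.
Proof.
move=> g0 pg; suff /eqP : p * g = 0 by rewrite mulf_eq0 (negbTE g0) orbF => /eqP.
apply/eqP; apply: contraT => pg0.
have := @max_poly_roots _ (p * g) [seq k%:R | k <- iota 0 (size (p * g))] pg0.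
rewrite size_map size_iota ltnn => -> //.
- apply/allP => _ /mapP[k _ ->]; rewrite rootE hornerM.
  by case: (eqVneq g.[k%:R] 0) => [->|/pg->]; rewrite ?mulr0 ?mul0r.
- rewrite map_inj_uniq ?iota_uniq // => k l /eqP.
  by rewrite eqr_nat => /eqP.
Qed.

Lemma cayley_den_neq0 k : 1 - 'i%R * k%:R != 0 :> F.
Proof.
have : (1 - 'i%R * k%:R) * (1 + 'i%R * k%:R) != 0 :> F.
  rewrite -subr_sqr expr1n exprMn sqrCi mulN1r opprK -natrX addrC.
  by rewrite natr1 pnatr_eq0.
by rewrite mulf_eq0 negb_or => /andP[].
Qed.

(** The Cayley image of a natural number: an infinite supply of points of the unit circle. *)
Definition circle_pt k : F := (1 + 'i%R * k%:R) / (1 - 'i%R * k%:R).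

Lemma circle_ptP k : (circle_pt k)^* * circle_pt k = 1.
Proof.
have d := cayley_den_neq0 k.
have cd : (1 - 'i%R * k%:R : F)^* = 1 + 'i%R * k%:R.
  by rewrite rmorphB rmorphM /= conjCi rmorph_nat rmorph1 mulNr opprK.
have cn : (1 + 'i%R * k%:R : F)^* = 1 - 'i%R * k%:R.
  by rewrite rmorphD rmorphM /= conjCi rmorph_nat rmorph1 mulNr.
rewrite /circle_pt rmorphM fmorphV /= cd cn mulf_div [X in _ / X]mulrC divff //.
by rewrite mulf_neq0 // -cd conjC_eq0.
Qed.

Lemma circle_pt_inj : injective circle_pt.
Proof.
move=> k l /eqP; rewrite /circle_pt eqr_div ?cayley_den_neq0 //.
set x := 'i%R * k%:R; set y := 'i%R * l%:R.
have -> : ((1 + x) * (1 - y) == (1 + y) * (1 - x)) = (2%:R * x == 2%:R * y).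
  by rewrite -subr_eq0 -[RHS]subr_eq0; congr (_ == 0); ring.
rewrite (inj_eq (mulfI _)) ?pnatr_eq0 // (inj_eq (mulfI (neq0Ci _))).
by rewrite eqr_nat => /eqP.
Qed.

Lemma circle_nonroot (p : {poly F}) : p != 0 ->
  exists2 l : F, l^* * l = 1 & p.[l] != 0.
Proof.
move=> p0; have [/hasP[k _ pk]|] := boolP (has (fun k => p.[circle_pt k] != 0)
  (iota 0 (size p))).
  by exists (circle_pt k); rewrite ?circle_ptP.
rewrite -all_predC => /allP pr.
have := @max_poly_roots _ p [seq circle_pt k | k <- iota 0 (size p)] p0.
rewrite size_map size_iota ltnn => no_roots; suff : false by [].
apply: no_roots.
- by apply/allP => _ /mapP[k /pr /= + ->]; rewrite negbK.
- by rewrite (map_inj_uniq circle_pt_inj) iota_uniq.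
Qed.

(** The indeterminate is treated as real, so evaluation commutes with the adjoint at natural
    numbers, and coefficients are conjugated degree by degree. *)
Definition ctpoly m n (P : 'M[{poly F}]_(m, n)) : 'M[{poly F}]_(n, m) :=
  map_mx (map_poly (@Num.conj F)) P^T.

Lemma evmx_ctpoly m n (P : 'M_(m, n)) (k : nat) :
  evmx k%:R (ctpoly P) = (evmx k%:R P)^t*.
Proof.
apply/matrixP => i j; rewrite !mxE /horner_eval.
by rewrite -[in LHS](rmorph_nat (@Num.conj F)) horner_map.
Qed.

Lemma coefmx_ctpoly m n (P : 'M_(m, n)) k :
  coefmx k (ctpoly P) = (coefmx k P)^t*.
Proof. by apply/matrixP => i j; rewrite !mxE /= coef_map. Qed.

(** Once polynomial, the identity can be expanded at 0 or evaluated at a root of g. *)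
Lemma ctpoly_identity m (P : 'M[{poly F}]_m) (X : 'M[F]_m) (d g : {poly F}) :
  g != 0 ->
  (forall k : nat, g.[k%:R] != 0 ->
     (evmx k%:R P)^t* *m X *m evmx k%:R P = (d.[k%:R]^* * d.[k%:R]) *: X) ->
  ctpoly P *m map_mx polyC X *m P = (map_poly (@Num.conj F) d * d) *: map_mx polyC X.
Proof.
move=> g0 PX; apply/eqP; rewrite -subr_eq0; apply/eqP/matrixP => i j.
rewrite [RHS]mxE; apply: (poly_nat_eq0 g0) => k gk.
have e : evmx k%:R (ctpoly P *m map_mx polyC X *m P -
    (map_poly (@Num.conj F) d * d) *: map_mx polyC X) = 0.
  rewrite -[X in _ - X]scale1r -scaleNr scalerA evmxD evmxZ !evmxM evmx_ctpoly evmxC.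
  rewrite PX // mulN1r hornerN hornerM scaleNr.
  rewrite -[in X in _ - X](rmorph_nat (@Num.conj F)).
  by rewrite horner_map /= rmorph_nat subrr.
by have /matrixP/(_ i j) := e; rewrite !mxE.
Qed.

End PointsOfEvaluation.

Section CayleyAlgebra.
Variable K : fieldType.

(* The substitution W = l (1 + X) (1 - X)^-1 in the transfer function. *)
Lemma cayley_transfer_at r q n (A : 'M[K]_r) (B : 'M_(r, q)) (C : 'M_(q, r)) (D : 'M_q)
    (l : K) (X W : 'M[K]_(r * n)) :
  1%:M - l *: A \in unitmx ->
  let G := invmx (1%:M - l *: A) in
  let A' := (1%:M + l *: A) *m G in
  1%:M - X \in unitmx -> 1%:M - lift1 n A' *m X \in unitmx ->
  W *m (1%:M - X) = l *: (1%:M + X) ->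
  1%:M - lift1 n A *m W \in unitmx /\
  transfer_at A B C D W =
    transfer_at A' ((2%:R * l) *: (G *m B)) (C *m G) (D + l *: (C *m G *m B)) X.
Proof.
move=> uF G A'; set LA := lift1 n A; set LG := lift1 n G.
set U := 1%:M - X; set Nm := 1%:M - _ => uU uN WU.
have LFE : lift1 n (1%:M - l *: A) = 1%:M - l *: LA.
  by rewrite lift1D lift11 lift1N lift1Z.
have FG : (1%:M - l *: LA) *m LG = 1%:M by rewrite -LFE -lift1M mulmxV // lift11.
have GF : LG *m (1%:M - l *: LA) = 1%:M by rewrite -LFE -lift1M mulVmx // lift11.
have uLF := (mulmx1_unit FG).1.
have NE : Nm = 1%:M + X - 2%:R *: (LG *m X).
  rewrite /Nm /A' cayley_mxE // lift1D lift1N lift11 lift1Z -/LG.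
  by rewrite mulmxBl mul1mx -scalemxAl opprB addrA.
have UE : U = 1%:M - X by [].
have -> : transfer_at A' ((2%:R * l) *: (G *m B)) (C *m G) (D + l *: (C *m G *m B)) X =
  lift1 n D + l *: (lift1 n C *m LG *m lift1 n B) + lift1 n C *m LG *m X *m
   invmx Nm *m ((2%:R * l) *: (LG *m lift1 n B)).
  by rewrite /transfer_at -/Nm lift1D !lift1Z !lift1M.
clearbody U Nm LG.
(* The factorization (1 - A W) (1 - X) = (1 - l A) (1 - A' X) carries invertibility from the new
   pencil to the old one. *)
have MU : (1%:M - LA *m W) *m U = (1%:M - l *: LA) *m Nm.
  rewrite NE mulmxBr -scalemxAr (mulmxA _ LG) FG mul1mx mulmxBl -mulmxA WU mul1mx.
  rewrite mulmxBl mul1mx -scalemxAr scalemxAl UE scaler_nat mulr2n.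
  by rewrite [RHS]addrAC; congr (_ - _); rewrite opprD addrA addrK.
have uM : 1%:M - LA *m W \in unitmx.
  have : (1%:M - LA *m W) *m U \in unitmx by rewrite MU unitmx_mul uLF uN.
  by rewrite unitmx_mul => /andP[].
split=> //.
have WM : W *m invmx (1%:M - LA *m W) = l *: (LG + 2%:R *: (LG *m X *m invmx Nm *m LG)).
  apply: (can_inj (mulmxK uM)); rewrite mulmxKV //.
  apply: (can_inj (mulmxK uU)); rewrite WU -mulmxA MU -scalemxAl; congr (_ *: _).
  rewrite [RHS]mulmxDl mulmxA GF mul1mx -scalemxAl -!mulmxA (mulmxA LG (1%:M - _)) GF.
  by rewrite mul1mx mulVmx // mulmx1 NE subrK.
rewrite /transfer_at -(mulmxA _ W) WM -addrA; congr (_ + _).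
rewrite -scalemxAr -scalemxAl mulmxDr mulmxDl scalerDr; congr (_ + _).
rewrite -!(scalemxAr, scalemxAl) !scalerA mulrC; congr (_ *: _).
by rewrite !mulmxA.
Qed.

End CayleyAlgebra.

(** * The Stein equation *)

Section SteinAlgebra.
Variable F : numClosedFieldType.

Lemma ct_block_mx m1 m2 n1 n2 (A : 'M[F]_(m1, n1)) (B : 'M_(m1, n2))
    (C : 'M_(m2, n1)) (D : 'M_(m2, n2)) :
  (block_mx A B C D)^t* = block_mx (A^t*) (C^t*) (B^t*) (D^t*).
Proof. by rewrite tr_block_mx map_block_mx. Qed.

Lemma ct_lift1 n p q (A : 'M[F]_(p, q)) : (lift1 n A)^t* = lift1 n (A^t*).
Proof. by rewrite /lift1 trmx_tens map_mxT ctmx1. Qed.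

Lemma stein_blocks r q (A H : 'M[F]_r) (B : 'M_(r, q)) (C : 'M_(q, r)) (D J : 'M_q) :
  (block_mx A B C D)^t* *m block_mx H 0 0 J *m block_mx A B C D =
  block_mx (A^t* *m H *m A + C^t* *m J *m C) (A^t* *m H *m B + C^t* *m J *m D)
           (B^t* *m H *m A + D^t* *m J *m C) (B^t* *m H *m B + D^t* *m J *m D).
Proof. by rewrite ct_block_mx !mulmx_block !mulmx0 !addr0 !add0r. Qed.

Lemma quad_col_mx r q p (H : 'M[F]_r) (J : 'M_q) (x : 'M_(r, p)) (u : 'M_(q, p)) :
  (col_mx x u)^t* *m block_mx H 0 0 J *m col_mx x u =
  x^t* *m H *m x + u^t* *m J *m u.
Proof.
rewrite tr_col_mx map_row_mx mul_row_block !mulmx0 addr0 add0r.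
by rewrite mul_row_col.
Qed.

Lemma stein_lift n r q (A H : 'M[F]_r) (B : 'M_(r, q)) (C : 'M_(q, r)) (D J : 'M_q) :
  (block_mx A B C D)^t* *m block_mx H 0 0 J *m block_mx A B C D = block_mx H 0 0 J ->
  let M := block_mx (lift1 n A) (lift1 n B) (lift1 n C) (lift1 n D) in
  let K := block_mx (lift1 n H) 0 0 (lift1 n J) in M^t* *m K *m M = K.
Proof.
rewrite stein_blocks => /eq_block_mx[S11 S12 S21 S22] /=.
have lift10 p s : lift1 n (0 : 'M[F]_(p, s)) = 0 by exact: tens0mx.
rewrite stein_blocks !ct_lift1 -!lift1M -!lift1D.
by congr block_mx; rewrite ?S11 ?S12 ?S21 ?S22 ?lift10.
Qed.

Lemma stein_transfer_at n r q (A H : 'M[F]_r) (B : 'M_(r, q)) (C : 'M_(q, r))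
    (D J : 'M_q) (X : 'M_(r * n)) :
  (block_mx A B C D)^t* *m block_mx H 0 0 J *m block_mx A B C D = block_mx H 0 0 J ->
  X^t* *m lift1 n H *m X = lift1 n H -> 1%:M - lift1 n A *m X \in unitmx ->
  (transfer_at A B C D X)^t* *m lift1 n J *m transfer_at A B C D X = lift1 n J.
Proof.
move=> /(stein_lift n) /= SL XHX uM.
set LA := lift1 n A in SL uM; set LB := lift1 n B in SL.
set LC := lift1 n C in SL; set LD := lift1 n D in SL.
set LH := lift1 n H in SL XHX; set LJ := lift1 n J in SL *.
(* State equations y = A z + B, V = D + C z with z = X y. The balance closes because X preserves H,
   so that y and z have the same H-form. *)
pose y := invmx (1%:M - LA *m X) *m LB; pose z := X *m y.
have yE : y = LA *m z + LB.
  have <- : (1%:M - LA *m X) *m y = LB by exact: mulKVmx.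
  by rewrite mulmxBl mul1mx mulmxA addrC subrK.
have VE : transfer_at A B C D X = LD + LC *m z by rewrite /transfer_at /z /y !mulmxA.
have ME : block_mx LA LB LC LD *m col_mx z 1%:M = col_mx y (transfer_at A B C D X).
  by rewrite mul_block_col !mulmx1 -yE (addrC (LC *m z)) -VE.
have : (col_mx y (transfer_at A B C D X))^t* *m block_mx LH 0 0 LJ *m
      col_mx y (transfer_at A B C D X) =
    (col_mx z 1%:M)^t* *m block_mx LH 0 0 LJ *m col_mx z 1%:M.
  by rewrite -ME -[in RHS]SL ctmxM !mulmxA.
rewrite !quad_col_mx ctmx1 mul1mx mulmx1.
have -> : z^t* *m LH *m z = y^t* *m LH *m y.
  by rewrite /z ctmxM -[in RHS]XHX !mulmxA.
exact: addrI.
Qed.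

(* Conjugating the Lyapunov equations of the Cayley-transformed node by 1 - l A gives
   the blocks of the Stein equation. *)
Lemma lyapunov_stein r q (A S : 'M[F]_r) (B : 'M_(r, q)) (C : 'M_(q, r))
    (D J : 'M_q) (l : F) (H := 2%:R *: S) :
  l^* * l = 1 -> 1%:M - l *: A \in unitmx -> J^t* = J -> S^t* = S ->
  let G := invmx (1%:M - l *: A) in
  let A' := (1%:M + l *: A) *m G in let B' := (2%:R * l) *: (G *m B) in
  let C' := C *m G in let D' := D + l *: (C *m G *m B) in
  S *m A' + A'^t* *m S = C'^t* *m J *m C' -> S *m B' = C'^t* *m J *m D' ->
  D'^t* *m J *m D' = J ->
  (block_mx A B C D)^t* *m block_mx H 0 0 J *m block_mx A B C D = block_mx H 0 0 J.
Proof.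
move=> ll uF ctJ ctS G A' B' C' D' L1 L2 L3.
pose Fm := 1%:M - l *: A.
have ctH : H^t* = H by rewrite ctmxZ rmorph_nat ctS.
have A'F : A' *m Fm = 1%:M + l *: A by rewrite mulmxKV.
have C'F : C' *m Fm = C by rewrite mulmxKV.
pose b := l *: (G *m B).
have B'E : B' = 2%:R *: b by rewrite /B' -scalerA.
have D'E : D' = D + C *m b by rewrite /D' /b -scalemxAr mulmxA.
have Fb : Fm *m b = l *: B by rewrite /b -scalemxAr mulKVmx.
have FE : Fm = 1%:M - l *: A by [].
have HE : H = 2%:R *: S by [].
clearbody A' B' C' D' b Fm H.
pose a := l *: A.
have aHa : a^t* *m H *m a = A^t* *m H *m A.
  by rewrite ctmxZ -!scalemxAl -scalemxAr scalerA ll scale1r.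
have S1 : A^t* *m H *m A + C^t* *m J *m C = H.
  rewrite -aHa.
  have := congr1 (fun U => Fm^t* *m U *m Fm) L1.
  have -> : Fm^t* *m (C'^t* *m J *m C') *m Fm = C^t* *m J *m C.
    by rewrite -C'F ctmxM !mulmxA.
  rewrite mulmxDr mulmxDl -!mulmxA A'F !mulmxA -(ctmxM A' Fm) A'F => <-.
  rewrite FE -/a ctmxD ctmxN ctmxD ctmx1.
  rewrite !(mulmxDl, mulmxDr, mulmxBr, mulmxBl, mul1mx, mulmx1).
  rewrite !(mulmxN, mulNmx) HE scaler_nat mulr2n mulmxDr mulmxDl.
  move: (a^t* *m S *m a) (a^t* *m S) (S *m a) => w u v.
  by apply/matrixP => i j; rewrite !mxE; ring.
have CJC : C^t* *m J *m C = H - A^t* *m H *m A.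
  by apply/eqP; rewrite eq_sym subr_eq addrC S1.
(* This is (1 - l A) b = l B divided by l, whose inverse is l^*. *)
have Ab : A *m b = l^* *: b - B.
  have l0 : l != 0 by apply: contra_eq_neq ll => ->; rewrite mulr0 eq_sym oner_neq0.
  apply: (scalerI l0); rewrite scalerBr scalerA [l * _]mulrC ll scale1r -Fb FE.
  by rewrite mulmxBl mul1mx subKr scalemxAl.
have S2 : A^t* *m H *m B + C^t* *m J *m D = 0.
  have := congr1 (fun U => Fm^t* *m U) L2.
  rewrite !mulmxA -(ctmxM C' Fm) C'F D'E mulmxDr mulmxA CJC B'E.
  rewrite -scalemxAr scalemxAl scalemxAr -HE => e.
  have -> : C^t* *m J *m D = Fm^t* *m H *m b - (H - A^t* *m H *m A) *m b.
    by rewrite e addrK.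
  rewrite FE ctmxD ctmxN ctmx1 !(mulmxDl, mulNmx) mul1mx ctmxZ.
  rewrite -!scalemxAl -(mulmxA _ A b) Ab.
  rewrite mulmxBr -scalemxAr.
  move: (_ *: (A^t* *m H *m b)) (A^t* *m H *m B) (H *m b) => u v w.
  by apply/matrixP => i j; rewrite !mxE; ring.
have CJD : C^t* *m J *m D = - (A^t* *m H *m B).
  by apply/eqP; rewrite -addr_eq0 addrC S2.
have DJC : D^t* *m J *m C = - (B^t* *m H *m A).
  by apply: ctmx_inj; rewrite ctmxN !ctmxM !ctmxK ctJ ctH !mulmxA.
have S3 : B^t* *m H *m B + D^t* *m J *m D = J.
  have DJD : J = D^t* *m J *m D + (D^t* *m J *m C) *m b +
      (b^t* *m (C^t* *m J *m D) + b^t* *m (C^t* *m J *m C) *m b).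
    rewrite -[LHS]L3 D'E ctmxD ctmxM !(mulmxDl, mulmxDr) !mulmxA.
    by rewrite -!addrA; congr (_ + _); rewrite addrCA.
  have bHb : b^t* *m H *m b = (B + A *m b)^t* *m H *m (B + A *m b).
    rewrite Ab addrC subrK ctmxZ conjCK -!(scalemxAl, scalemxAr) scalerA.
    by rewrite mulrC ll scale1r.
  rewrite [RHS]DJD DJC CJD CJC mulmxBr mulmxBl bHb ctmxD ctmxM.
  rewrite !(mulmxDl, mulmxDr, mulmxN, mulNmx, mulmxA).
  move: (B^t* *m H *m B) (B^t* *m H *m A *m b) => x y.
  move: (b^t* *m A^t* *m H *m B) (b^t* *m A^t* *m H *m A *m b) => u v.
  by apply/matrixP => i j; rewrite !mxE; ring.
by rewrite stein_blocks S1 S2 S3 DJC addrN.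
Qed.

End SteinAlgebra.

Section Delta.
Variables (F : numClosedFieldType) (N r n : nat) (E : 'I_N -> 'M[F]_r).
Hypothesis EE : forall i j, E i *m E j = if i == j then E i else 0.
Hypothesis sumE : \sum_k E k = 1%:M.
Implicit Types U V W : 'I_N -> 'M[F]_n.

Lemma deltaM U V : delta E U *m delta E V = delta E (fun k => U k *m V k).
Proof.
rewrite /delta mulmx_suml; apply: eq_bigr => k _.
rewrite mulmx_sumr (bigD1 k) //= tensmx_mul EE eqxx big1 ?addr0 // => j jk.
by rewrite tensmx_mul EE eq_sym (negbTE jk) tens0mx.
Qed.

Lemma delta1 : delta E (fun=> 1%:M : 'M_n) = 1%:M.
Proof.
rewrite -[RHS](lift11 _ n r) -sumE /lift1 /delta.
apply/esym; apply: (big_morph (fun X : 'M[F]_r => X *t (1%:M : 'M_n))) => [X Y|].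
  exact: tensmxDl.
exact: tens0mx.
Qed.

Lemma deltaD U V : delta E (fun k => U k + V k) = delta E U + delta E V.
Proof. by rewrite /delta -big_split; apply: eq_bigr => k _; rewrite tensmxDr. Qed.

Lemma deltaZ a U : delta E (fun k => a *: U k) = a *: delta E U.
Proof. by rewrite /delta scaler_sumr; apply: eq_bigr => k _; rewrite tensmxZr. Qed.

Lemma eq_delta U V : U =1 V -> delta E U = delta E V.
Proof. by move=> UV; apply: eq_bigr => k _; rewrite UV. Qed.

Lemma ct_delta U : (forall k, (E k)^t* = E k) ->
  (delta E U)^t* = delta E (fun k => (U k)^t*).
Proof.
move=> ctE; rewrite ctmx_sum; apply: eq_bigr => k _.
by rewrite trmx_tens map_mxT ctE.
Qed.

Lemma delta_unitary W (H : 'M_r) : (forall k, (E k)^t* = E k) ->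
  (forall k, E k *m H = H *m E k) -> (forall k, W k \is unitarymx) ->
  (delta E W)^t* *m lift1 n H *m delta E W = lift1 n H.
Proof.
move=> ctE HE uW; rewrite -mulmxA.
have -> : lift1 n H *m delta E W = delta E W *m lift1 n H.
  rewrite mulmx_sumr mulmx_suml; apply: eq_bigr => k _.
  by rewrite /lift1 !tensmx_mul HE mul1mx mulmx1.
rewrite mulmxA ct_delta // deltaM (@eq_delta _ (fun=> 1%:M)) ?delta1 ?mul1mx // => k.
by apply: mulmx1C; apply/unitarymxP.
Qed.

End Delta.

(** * Unitarity of the values *)

Section MatrixOfExpressions.
Variables (K : fieldType) (N q n : nat) (e : 'I_q -> 'I_q -> ncrat K N).
Variables (Z : 'I_N -> 'M[{poly K}]_n) (dl : 'I_N -> {poly K}).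

Local Notation frac i j := (ncrat_frac Z dl (e i j)).

Definition eval_mx (ZZ : 'I_N -> 'M[K]_n) : 'M[K]_(q * n) :=
  \matrix_(x, y) ncrat_eval ZZ (e (mxtens_unindex x).1 (mxtens_unindex y).1)
    (mxtens_unindex x).2 (mxtens_unindex y).2.

Lemma blk_eval_mx ZZ i j : blk (eval_mx ZZ) i j = ncrat_eval ZZ (e i j).
Proof. by apply/matrixP => a b; rewrite !mxE !mxtens_indexK. Qed.

(** One denominator for all q^2 entries, non-zero exactly where every chosen expression is
    defined. *)
Definition common_den : {poly K} := \prod_(p : 'I_q * 'I_q) (frac p.1 p.2).2.

Definition common_num : 'M[{poly K}]_(q * n) :=
  \matrix_(x, y)
    (let p := ((mxtens_unindex x).1, (mxtens_unindex y).1) in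
     (\prod_(p' | p' != p) (frac p'.1 p'.2).2) *
       (frac p.1 p.2).1 (mxtens_unindex x).2 (mxtens_unindex y).2).

Variables (t : K) (ZZ : 'I_N -> 'M[K]_n).
Hypothesis dl_neq0 : forall k, (dl k).[t] != 0.
Hypothesis ZE : forall k, evmx t (Z k) = (dl k).[t] *: ZZ k.

Lemma common_denP :
  common_den.[t] != 0 <-> forall i j, ncrat_defined ZZ (e i j).
Proof.
rewrite /common_den horner_prod; split.
  move=> /prodf_neq0 d0 i j; have := d0 (i, j) isT.
  by rewrite (ncrat_frac_eval _ dl_neq0 ZE).1.
move=> de; apply/prodf_neq0 => -[i j] _.
by rewrite -(ncrat_frac_eval _ dl_neq0 ZE).1.
Qed.

Lemma common_numP : common_den.[t] != 0 ->
  evmx t common_num = common_den.[t] *: eval_mx ZZ.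
Proof.
move=> /common_denP de; apply/matrixP => x y.
case: (mxtens_indexP x) => i a; case: (mxtens_indexP y) => j b.
rewrite !mxE !mxtens_indexK /= /horner_eval.
rewrite [LHS](hornerM (\prod_(p' | p' != (i, j)) (frac p'.1 p'.2).2)
  ((frac i j).1 a b) t).
have /matrixP/(_ a b) := (ncrat_frac_eval _ dl_neq0 ZE).2 (de i j).
rewrite !mxE /horner_eval => ->; rewrite mulrA; congr (_ * _).
have -> : common_den = (frac i j).2 * \prod_(p' | p' != (i, j)) (frac p'.1 p'.2).2.
  by rewrite /common_den (bigD1 (i, j)).
by rewrite hornerM mulrC.
Qed.

End MatrixOfExpressions.

Section Unitarity.
Variables (F : numClosedFieldType) (N r q : nat) (E : 'I_N -> 'M[F]_r).
Hypothesis EE : forall i j, E i *m E j = if i == j then E i else 0.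
Hypothesis sumE : \sum_k E k = 1%:M.
Hypothesis ctE : forall k, (E k)^t* = E k.
Variables (A : 'M[F]_r) (B : 'M[F]_(r, q)) (C : 'M[F]_(q, r)) (D J : 'M[F]_q).
Hypothesis JJ : J *m J = 1%:M.

Local Notation f := (transfer E A B C D).

(** If V^* X V = X, then X V^* X is a left inverse of the square matrix V, hence a right inverse.
    The energy balance yields this form, [matrix_J_unitary] uses the other. *)
Lemma unitary_flip m (X V : 'M[F]_m) : X *m X = 1%:M ->
  (V^t* *m X *m V = X) <-> (V *m X *m V^t* = X).
Proof.
move=> XX; split=> VX.
  have /mulmx1C V1 : X *m (V^t* *m X) *m V = 1%:M by rewrite -mulmxA VX.
  by rewrite -[RHS]mul1mx -V1 -!mulmxA XX mulmx1.
have /mulmx1C V1 : V *m (X *m V^t* *m X) = 1%:M by rewrite !mulmxA VX.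
by rewrite -[RHS]mulmx1 -V1 !mulmxA XX mul1mx.
Qed.

Lemma lift1JJ n : lift1 n J *m lift1 n J = 1%:M.
Proof. by rewrite -lift1M JJ lift11. Qed.

(* When f(W) is defined but the pencil is singular at W, the identity is obtained
   at cW for almost all c on the unit circle and extended to c = 1. *)
Lemma stein_J_unitary (H : 'M[F]_r) : (forall k, E k *m H = H *m E k) ->
  (block_mx A B C D)^t* *m block_mx H 0 0 J *m block_mx A B C D =
    block_mx H 0 0 J ->
  matrix_J_unitary J f.
Proof.
move=> HE stein n _ W uW V fV.
have /fin_all_exists[e eP] i := fin_all_exists (fV i).
apply/(unitary_flip _ (lift1JJ n)).
(* For real t, c = nu / dl lies on the unit circle, with c = 1 at t = 0 and [circle_pt] at natural
   t. *)
pose dl : {poly F} := 1 - 'i%:P * 'X.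
pose nu : {poly F} := 1 + 'i%:P * 'X.
pose Z k := nu *: map_mx polyC (W k).
have ZE t k : dl.[t] != 0 -> evmx t (Z k) = dl.[t] *: ((nu.[t] / dl.[t]) *: W k).
  by move=> d0; rewrite evmxZ evmxC scalerA mulrC divfK.
have dl0 : dl.[0] = 1 by rewrite !hornerE ?mulr0 ?subr0.
have nu0 : nu.[0] = 1 by rewrite !hornerE ?mulr0 ?addr0.
pose d := common_den e Z (fun=> dl); pose P := common_num e Z (fun=> dl).
have evW k : (nu.[0] / dl.[0]) *: W k = W k by rewrite nu0 dl0 divr1 scale1r.
have d0 : d.[0] != 0.
  apply/(@common_denP _ _ _ _ e Z (fun=> dl) 0 W) => [k|k|i j].
  - by rewrite dl0 oner_neq0.
  - by rewrite ZE ?evW // dl0 oner_neq0.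
  - by have [] := eP i j.
have P0 : evmx 0 P = d.[0] *: V.
  rewrite (@common_numP _ _ _ _ e Z (fun=> dl) 0 W) //.
  - congr (_ *: _); apply: blkP => i j; rewrite blk_eval_mx.
    by have [_ _ ->] := eP i j.
  - by move=> k; rewrite dl0 oner_neq0.
  - by move=> k; rewrite ZE ?evW // dl0 oner_neq0.
(* Homogenized determinant of the pencil at c W; it may vanish at t = 0. *)
pose pm := \det (dl *: 1%:M - nu *: map_mx polyC (lift1 n A *m delta E W)).
have pmE t : dl.[t] != 0 -> pm.[t] != 0 ->
    \det (1%:M - lift1 n A *m delta E (fun k => (nu.[t] / dl.[t]) *: W k)) != 0.
  move=> dt; rewrite -det_evmx evmxD -scaleNr !evmxZ evmx1 evmxC hornerN.
  apply: contra_neq => pt; rewrite [X in \det X](_ : _ = dl.[t] *: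
    (1%:M - lift1 n A *m delta E (fun k => (nu.[t] / dl.[t]) *: W k))).
    by rewrite detZ pt mulr0.
  rewrite deltaZ scalerBr -scalemxAr scalerA scaleNr.
  by rewrite [dl.[t] * _]mulrC divfK.
have g0 : d * dl * pm != 0.
  rewrite !mulf_neq0 //.
  - by apply: contra_neq d0 => ->; rewrite horner0.
  - by apply: contra_eq_neq dl0 => ->; rewrite horner0 eq_sym oner_neq0.
  (* At t = i one has nu = 0 and dl = 2, so c = 0 and the pencil is the identity. *)
  - apply: (@contra_neq _ _ _ _ _ 0 _ (_ : pm.['i] != 0)) => [->|].
      by rewrite horner0.
    rewrite -det_evmx evmxD -scaleNr !evmxZ evmx1 hornerN !hornerE.
    rewrite -expr2 sqrCi opprK subrr oppr0 scale0r addr0 detZ det1 mulr1.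
    by rewrite expf_neq0 // -mulr2n pnatr_eq0.
have PI : ctpoly P *m map_mx polyC (lift1 n J) *m P =
    (map_poly (@Num.conj F) d * d) *: map_mx polyC (lift1 n J).
  apply: (ctpoly_identity g0) => k.
  rewrite !hornerM !mulf_eq0 !negb_or -andbA => /and3P[dk dlk pk].
  have ck : nu.[k%:R] / dl.[k%:R] = circle_pt F k by rewrite !hornerE.
  set Wk := fun i => (nu.[k%:R] / dl.[k%:R]) *: W i.
  have uWk i : Wk i \is unitarymx.
    apply/unitarymxP; rewrite /Wk ck ctmxZ -scalemxAl -scalemxAr scalerA.
    by rewrite mulrC circle_ptP scale1r; apply/unitarymxP.
  have fk : fps_value f Wk (eval_mx e Wk).
    move=> i j; exists (e i j); have [re _ _] := eP i j; split=> //.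
      move: i j {re}; apply/(@common_denP _ _ _ _ e Z (fun=> dl) k%:R) => // i.
      exact: ZE.
    by rewrite -blk_eval_mx.
  rewrite /P (@common_numP _ _ _ _ e Z (fun=> dl) k%:R Wk) //; last first.
    by move=> i; exact: ZE.
  rewrite (value_transfer fk); last exact: pmE.
  rewrite ctmxZ -!scalemxAl -scalemxAr scalerA; congr (_ *: _).
  apply: (stein_transfer_at stein); first exact: delta_unitary.
  by rewrite unitmxE unitfE pmE.
(* Back to c = 1: only d has to be non-zero there, and it is because f(W) is defined. *)
have := congr1 (evmx 0%:R) PI; rewrite evmxZ !evmxM evmxC evmx_ctpoly P0 hornerM.
rewrite -[X in _.[X] * _](rmorph0 (@Num.conj F)) horner_map /= ctmxZ.
rewrite -!scalemxAl -scalemxAr !scalerA => /scalerI; apply.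
by rewrite mulf_neq0 // conjC_eq0.
Qed.
End Unitarity.

Section CayleyUnitary.
Variable F : numClosedFieldType.

(** With U = 1 - X, skewness gives 1 + X = U^*, and U commutes with U^*. *)
Lemma cayley_unitarymx n (l : F) (X : 'M[F]_n) : l^* * l = 1 -> X^t* = - X ->
  1%:M - X \in unitmx -> l *: ((1%:M + X) *m invmx (1%:M - X)) \is unitarymx.
Proof.
move=> ll skX uU; set U := 1%:M - X.
have UE : 1%:M + X = U^t* by rewrite /U ctmxD ctmxN ctmx1 skX opprK.
have UC : U *m U^t* = U^t* *m U.
  by rewrite -UE /U mulmxBl mulmxBr mul1mx mulmx1 mulmxDr mulmxDl mul1mx mulmx1.
apply/unitarymxP/mulmx1C; rewrite ctmxZ ctmxM UE ctmxK -scalemxAl -scalemxAr scalerA ll.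
rewrite scale1r -mulmxA (mulmxA U) UC -mulmxA mulmxV // mulmx1.
by rewrite -ctmxM mulmxV // ctmx1.
Qed.

Lemma eqmodX_ctpoly m p s (P Q : 'M[{poly F}]_(p, s)) :
  eqmodX m P Q -> eqmodX m (ctpoly P) (ctpoly Q).
Proof. by move=> PQ k km; rewrite !coefmx_ctpoly PQ. Qed.

Lemma ctpolyZ p s (d : {poly F}) (P : 'M[{poly F}]_(p, s)) :
  ctpoly (d *: P) = map_poly (@Num.conj F) d *: ctpoly P.
Proof. by apply/matrixP => i j; rewrite !mxE rmorphM. Qed.

Variables (N r q : nat) (E : 'I_N -> 'M[F]_r).
Hypothesis EE : forall i j, E i *m E j = if i == j then E i else 0.
Hypothesis sumE : \sum_k E k = 1%:M.
Variables (A : 'M[F]_r) (B : 'M[F]_(r, q)) (C : 'M[F]_(q, r)) (D J : 'M[F]_q).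
Hypothesis JJ : J *m J = 1%:M.
Local Notation f := (transfer E A B C D).
Hypothesis fJ : matrix_J_unitary J f.
Variable e : 'I_q -> 'I_q -> ncrat F N.
Hypothesis re : forall i j, represents (e i j) (fps_entry f i j).
Variable l : F.
Hypothesis ll : l^* * l = 1.
Hypothesis uF : 1%:M - l *: A \in unitmx.
Hypothesis de : forall i j, ncrat_defined (fun=> l%:M : 'M_1) (e i j).

Local Notation G := (invmx (1%:M - l *: A)).
Local Notation A' := ((1%:M + l *: A) *m G).
Local Notation B' := ((2%:R * l) *: (G *m B)).
Local Notation C' := (C *m G).
Local Notation D' := (D + l *: (C *m G *m B)).
Local Notation f' := (transfer E A' B' C' D').

Section SkewPath.
Variables (n : nat) (Y : 'I_N -> 'M[F]_n).
Hypothesis n_gt0 : (0 < n)%N.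
Hypothesis skY : forall k, (Y k)^t* = - Y k.

Local Notation den := (\det (pencil E A' Y)).
Local Notation num := (transfer_num E A' B' C' D' Y).

(** For natural s outside the roots of a polynomial that is non-zero at 0, W(s) = l (1 + s Y) (1 - s
    Y)^-1 is a unitary tuple at which f is defined, and [cayley_transfer_at] carries J-unitarity
    there over to the new node at s Y. *)
Lemma cayley_path_identity :
  ctpoly num *m map_mx polyC (lift1 n J) *m num =
  (map_poly (@Num.conj F) den * den) *: map_mx polyC (lift1 n J).
Proof.
pose Pm k := 1%:M - 'X *: map_mx polyC (Y k).
pose Z k := l%:P *: ((1%:M + 'X *: map_mx polyC (Y k)) *m \adj (Pm k)).
pose dl k := \det (Pm k).
pose W t k := l *: ((1%:M + t *: Y k) *m invmx (1%:M - t *: Y k)).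
have PmE t k : evmx t (Pm k) = 1%:M - t *: Y k.
  by rewrite /Pm evmxD -scaleNr evmxZ evmx1 evmxC hornerN hornerX scaleNr.
have dlE t k : (dl k).[t] = \det (1%:M - t *: Y k) by rewrite -det_evmx PmE.
have ZE t k : (dl k).[t] != 0 -> evmx t (Z k) = (dl k).[t] *: W t k.
  rewrite dlE => d0; rewrite evmxZ hornerC evmxM evmxD evmx1 evmxZ evmxC hornerX.
  rewrite adj_evmx PmE /W /invmx unitmxE unitfE d0 -scalemxAr !scalerA.
  by rewrite mulrAC divff // mul1r.
have dl0 k : (dl k).[0] = 1 by rewrite dlE scale0r subr0 det1.
have W0 k : W 0 k = l%:M.
  by rewrite /W scale0r addr0 subr0 mul1mx invmx1 scalemx1.
have den0 : den.[0] = 1 by rewrite det_pencil scale0r mulmx0 subr0 det1.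
pose d := common_den e Z dl.
(* s = 0 corresponds to the point (l, ..., l), where the expressions are defined by the choice of
   l. *)
have d0 : d.[0] != 0.
  apply/(@common_denP _ _ _ _ e Z dl 0 (fun=> l%:M)) => [k|k|i j].
  - by rewrite dl0 oner_neq0.
  - by rewrite ZE ?W0 // dl0 oner_neq0.
  - by have [x /(_ n)[]] := ncrat_eval_scalar (de i j).
have g0 : d * \prod_k dl k * den != 0.
  have nz (p : {poly F}) : p.[0] != 0 -> p != 0.
    by apply: contra_neq => ->; rewrite horner0.
  rewrite !mulf_neq0 ?nz ?den0 ?oner_neq0 // horner_prod.
  by apply/prodf_neq0 => k _; rewrite dl0 oner_neq0.
apply: (ctpoly_identity g0) => s.
rewrite !hornerM !mulf_eq0 !negb_or -andbA => /and3P[ds dls dens].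
have {}dls k : (dl k).[s%:R] != 0.
  by move: dls; rewrite horner_prod => /prodf_neq0 /(_ k); apply.
have uU k : 1%:M - s%:R *: Y k \in unitmx by rewrite unitmxE unitfE -dlE.
have uW k : W s%:R k \is unitarymx.
  by apply: cayley_unitarymx => //; rewrite ctmxZ skY rmorph_nat scalerN.
have fW : fps_value f (W s%:R) (eval_mx e (W s%:R)).
  move=> i j; exists (e i j); split=> //; last by rewrite -blk_eval_mx.
  by move: i j; apply/(@common_denP _ _ _ _ e Z dl s%:R) => // k; exact: ZE.
have VJ := (unitary_flip _ (lift1JJ JJ n)).2 (fJ n_gt0 uW fW).
pose X := s%:R *: delta E Y.
have XE : 1%:M - X = delta E (fun k => 1%:M - s%:R *: Y k).
  rewrite (@eq_delta _ _ _ _ E _ (fun k => 1%:M + (- s%:R) *: Y k)) => [|k].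
    by rewrite deltaD delta1 // deltaZ scaleNr.
  by rewrite scaleNr.
have uX : 1%:M - X \in unitmx.
  have : delta E (fun k => 1%:M - s%:R *: Y k) *m
      delta E (fun k => invmx (1%:M - s%:R *: Y k)) = 1%:M.
    rewrite deltaM // (@eq_delta _ _ _ _ E _ (fun=> 1%:M)) ?delta1 // => k.
    exact: mulmxV.
  by rewrite -XE => /mulmx1_unit[].
have WX : delta E (W s%:R) *m (1%:M - X) = l *: (1%:M + X).
  rewrite XE deltaM // (@eq_delta _ _ _ _ E _ (fun k => l *: (1%:M + s%:R *: Y k))).
    by rewrite deltaZ deltaD delta1 // deltaZ.
  by move=> k; rewrite /W -scalemxAl mulmxKV.
have uN : 1%:M - lift1 n A' *m X \in unitmx by rewrite unitmxE unitfE -det_pencil.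
have [uAW tE] := cayley_transfer_at B C D uF uX uN WX.
move: VJ; rewrite (value_transfer fW) -?unitfE -?unitmxE // tE => VJ.
by rewrite transfer_num_eval // ctmxZ -!scalemxAl -scalemxAr scalerA VJ.
Qed.

(** [den] has constant term 1, so the scalar factor of [cayley_path_identity] cancels in power
    series and degrees can be compared. *)
Lemma cayley_series_unitary k :
  \sum_(i < k.+1) (mcoef Y f' i)^t* *m lift1 n J *m mcoef Y f' (k - i) =
  if k is 0 then lift1 n J else 0.
Proof.
pose Fk := trunc k.+1 (mcoef Y f').
have dF : eqmodX k.+1 (den *: Fk) num by exact: transfer_num_series.
have den0 : den`_0 = 1.
  by rewrite -horner_coef0 det_pencil scale0r mulmx0 subr0 det1.
have : eqmodX k.+1 (ctpoly Fk *m map_mx polyC (lift1 n J) *m Fk)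
    (map_mx polyC (lift1 n J)).
  apply: (@eqmodXZ_inj _ _ _ _ (map_poly (@Num.conj F) den * den)).
    by rewrite coef0M coef_map /= den0 conjC1 mulr1 oner_neq0.
  rewrite -cayley_path_identity (_ : _ *: _ =
    ctpoly (den *: Fk) *m map_mx polyC (lift1 n J) *m (den *: Fk)).
    by apply: eqmodXM => //; apply: eqmodXM => //; exact: eqmodX_ctpoly.
  by rewrite ctpolyZ -scalemxAr -!scalemxAl scalerA [den * _]mulrC.
move=> /(_ k (ltnSn k)); rewrite coefmxC => <-.
rewrite coefmxM; apply: eq_bigr => i _.
have ik : (i <= k)%N by rewrite -ltnS.
congr (_ *m _); last by rewrite coef_trunc // ltnS leq_subr.
rewrite coefmxM big_ord_recr /= subnn coefmxC coefmx_ctpoly coef_trunc //.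
rewrite big1 ?add0r // => j _; rewrite coefmxC.
by case: (i - j)%N (subn_gt0 j i) => [|u]; rewrite ?ltn_ord // mulmx0.
Qed.

End SkewPath.
End CayleyUnitary.

(** * The equivalence *)

Section MinimalNodes.
Variables (F : numClosedFieldType) (N q : nat).

Lemma ct_bproj (d : 'I_N -> nat) k : (bproj F d k)^t* = bproj F d k.
Proof.
rewrite tr_bproj -[bproj F d k]mulmx1 bproj_mulmx.
by apply/matrixP => i j; rewrite !mxE rmorphM !rmorph_nat.
Qed.

(** The two block diagonal matrices are mutually inverse, so either equation gives a one-sided
    inverse of the square matrix M, which is then two-sided. *)
Lemma stein_costein r (H : 'M[F]_r) (J : 'M_q) (M : 'M_(r + q)) :
  H \in unitmx -> J *m J = 1%:M ->
  M^t* *m block_mx H 0 0 J *m M = block_mx H 0 0 J <->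
  M *m block_mx (invmx H) 0 0 J *m M^t* = block_mx (invmx H) 0 0 J.
Proof.
move=> uH JJ; set K := block_mx H 0 0 J; set L := block_mx (invmx H) 0 0 J.
have KL : K *m L = 1%:M.
  by rewrite mulmx_block !mulmx0 !mul0mx !addr0 add0r mulmxV // JJ -scalar_mx_block.
have LK := mulmx1C KL.
split=> MK.
  have /mulmx1C M1 : L *m (M^t* *m K) *m M = 1%:M by rewrite -mulmxA MK.
  by rewrite -[RHS]mul1mx -M1 -!mulmxA KL mulmx1.
have /mulmx1C M1 : M *m (L *m M^t* *m K) = 1%:M by rewrite !mulmxA MK.
by rewrite -[RHS]mulmx1 -M1 !mulmxA KL mul1mx.
Qed.

(** On the line (t, ..., t), det(1 - t A) times the common denominator is non-zero at t = 0; a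
    non-zero polynomial cannot vanish on the whole unit circle. *)
Lemma exists_cayley_point r (A : 'M[F]_r) (f : seq 'I_N -> 'M[F]_q)
    (e : 'I_q -> 'I_q -> ncrat F N) :
  (forall i j, represents (e i j) (fps_entry f i j)) ->
  exists l : F, [/\ l^* * l = 1, 1%:M - l *: A \in unitmx &
    forall i j, ncrat_defined (fun=> l%:M : 'M_1) (e i j)].
Proof.
move=> re; pose Q : 'M[{poly F}]_r := 1%:M - 'X *: map_mx polyC A.
pose Z (_ : 'I_N) : 'M[{poly F}]_1 := 'X%:M.
have QE t : (\det Q).[t] = \det (1%:M - t *: A).
  by rewrite -det_evmx evmxD -scaleNr evmxZ evmx1 evmxC hornerN hornerX scaleNr.
have ZE t k : evmx t (Z k) = (1 : {poly F}).[t] *: t%:M.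
  by rewrite /evmx map_scalar_mx /= /horner_eval hornerX hornerE scale1r.
have dl t (k : 'I_N) : (1 : {poly F}).[t] != 0 by rewrite hornerE oner_neq0.
have [|l ll] := @circle_nonroot F (\det Q * common_den e Z (fun=> 1)).
  suff : (\det Q * common_den e Z (fun=> 1)).[0] != 0.
    by apply: contra_neq => ->; rewrite horner0.
  rewrite hornerM mulf_neq0 //; first by rewrite QE scale0r subr0 det1 oner_neq0.
  apply/(common_denP e (dl 0) (ZE 0)) => i j.
  rewrite (_ : (fun=> _) = fun=> 0); first by have [] := ncrat_eval0 1 (re i j).
  by rewrite raddf0.
rewrite hornerM mulf_eq0 negb_or QE => /andP[ul /(common_denP e (dl l) (ZE l)) de].
by exists l; split; rewrite // unitmxE unitfE.
Qed.

Lemma J_unitary_stein (J : 'M[F]_q) (f : seq 'I_N -> 'M[F]_q) (al : GR_node F N q) :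
  signature_mx J -> rational_fps f -> minimal_gr_realization al f ->
  matrix_J_unitary J f ->
  exists H, [/\ H \in unitmx, H^t* = H,
    forall k, bproj F (gr_dim al) k *m H = H *m bproj F (gr_dim al) k &
    (gr_matrix al)^t* *m block_mx H 0 0 J *m gr_matrix al = block_mx H 0 0 J].
Proof.
move=> [ctJ JJ] rf alf fJ.
have {rf} /fin_all_exists[e re] i := fin_all_exists (rf i).
have cAB := minimal_controllable alf; have cAC := minimal_observable alf.
have fE : f = transfer (bproj F (gr_dim al)) (gr_A al) (gr_B al) (gr_C al) (gr_D al).
  by apply/funext => w; rewrite -gr_transferE alf.1.
rewrite {}fE in fJ re; rewrite /gr_matrix.
set E := bproj F _ in cAB cAC fJ re *.
have EE : forall i j, E i *m E j = if i == j then E i else 0 by exact: bprojM.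
have sumE : \sum_k E k = 1%:M by exact: sum_bproj.
have ctE : forall k, (E k)^t* = E k by exact: ct_bproj.
have trE : forall k, (E k)^T = E k by exact: tr_bproj.
move: (gr_A al) (gr_B al) (gr_C al) (gr_D al) cAB cAC fJ re => A B C D cAB cAC fJ re.
have [l [ll uF de]] := exists_cayley_point A re.
have two0 : (2%:R : F) != 0 by rewrite pnatr_eq0.
have l0 : l != 0 by apply: contra_eq_neq ll => ->; rewrite mulr0 eq_sym oner_neq0.
have ser n Y n0 skY := @cayley_series_unitary _ _ _ _ _ EE sumE _ B C D J JJ fJ e re l
  ll uF de n Y n0 skY.
have DJD := feedthrough_unitary ser.
have gram0 := costate_gram0 ctE ser.
have cAB' := controllable_cayley EE sumE cAB two0 l0 (mulf_neq0 two0 l0) uF.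
have [S [ctS SE SA SB]] := lyapunov_solution EE sumE ctE (esym ctJ) gram0 cAB'.
exists (2%:R *: S); split.
- rewrite unitmxZ ?unitfE //.
  apply: (lyapunov_unit sumE (esym ctJ) _ trE JJ DJD ctS SE SA SB).
  (* The Cayley transform commutes with transposition, so the new node is observable by
     [controllable_cayley] for the dual pair, with m = 1 because C' = C G carries no scalar. *)
  have FT : 1%:M - l *: A^T = (1%:M - l *: A)^T.
    by apply/matrixP => i j; rewrite !mxE eq_sym.
  have uFT : 1%:M - l *: A^T \in unitmx by rewrite FT unitmx_tr.
  have /= := controllable_cayley EE sumE cAC two0 l0 (oner_neq0 _) uFT.
  have GT : invmx (1%:M - l *: A^T) = (invmx (1%:M - l *: A))^T.
    by rewrite FT trmx_inv.
  rewrite scale1r !cayley_mxE // GT trmx_mul (_ : (_ - _)^T = 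
    2%:R *: (invmx (1%:M - l *: A))^T - 1%:M) //.
  by apply/matrixP => i j; rewrite !mxE eq_sym.
- by rewrite ctmxZ rmorph_nat ctS.
- by move=> k; rewrite -scalemxAr SE scalemxAl.
- exact: (lyapunov_stein ll uF (esym ctJ) ctS SA SB DJD).
Qed.

End MinimalNodes.

Local Open Scope complex_scope.

Theorem theorem5p3 (R : realType) (N q : nat) (J : 'M[R[i]]_q)
    (f : seq 'I_N -> 'M[R[i]]_q) (al : GR_node R[i] N q) :
  signature_mx J ->
  rational_fps f ->
  minimal_gr_realization al f ->
  let M := gr_matrix al in
  let stein (H : 'M[R[i]]_(\sum_k gr_dim al k)) :=
    M^t* *m block_mx H 0 0 J *m M = block_mx H 0 0 J in
  let costein (H : 'M[R[i]]_(\sum_k gr_dim al k)) :=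
    M *m block_mx (invmx H) 0 0 J *m M^t* = block_mx (invmx H) 0 0 J in
  (matrix_J_unitary J f <->
   exists Hk : forall k, 'M[R[i]]_(gr_dim al k),
     [/\ \mxdiag_k Hk k \in unitmx, \mxdiag_k Hk k \is hermsymmx &
         stein (\mxdiag_k Hk k)]) /\
  (forall Hk : forall k, 'M[R[i]]_(gr_dim al k),
     \mxdiag_k Hk k \in unitmx -> \mxdiag_k Hk k \is hermsymmx ->
     (stein (\mxdiag_k Hk k) <-> costein (\mxdiag_k Hk k))).
Proof.
move=> sJ rf alf M stein costein; split; last first.
  by move=> Hk uH _; apply: stein_costein => //; case: sJ.
split=> [fJ|[Hk [uH hH sH]]].
  have [H [uH ctH HE sH]] := J_unitary_stein sJ rf alf fJ.
  exists (fun k => submxblock H k k); rewrite -bproj_comm_mxdiag //; split=> //.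
  by rewrite qualifE /= expr0 scale1r ctH.
have -> : f = transfer (bproj R[i] (gr_dim al)) (gr_A al) (gr_B al) (gr_C al) (gr_D al).
  by apply/funext => w; rewrite -gr_transferE alf.1.
apply: (stein_J_unitary _ _ _ sJ.2 _ sH).
- exact: bprojM.
- exact: sum_bproj.
- exact: ct_bproj.
- exact: bproj_mxdiagC.
Qed.
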